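(* The following formulas are true: $$\sum_{n=1}^{\infty}(-1)^{n+1}\frac{(1)_n^3}{\left(\frac12\right)_n^3}\frac{(4n-1)}{n^3}=16L_{-4}(2),$$ $$\sum_{n=1}^{\infty}\frac{(1)_n^3}{\left(\frac12\right)_n^3}\frac{(3n-1)}{n^3}\frac1{2^{2n}}=\frac{\pi^2}{2},$$ $$\sum_{n=1}^{\infty}\frac{(1)_n^3}{\left(\frac12\right)_n^3}\frac{(21n-8)}{n^3}\frac1{2^{6n}}=\frac{\pi^2}{6},$$ $$\sum_{n=1}^{\infty}(-1)^{n+1}\frac{(1)_n^3}{\left(\frac12\right)_n^3}\frac{(3n-1)}{n^3}\frac1{2^{3n}}=2L_{-4}(2),$$ $$\sum_{n=1}^{\infty}\frac{(1)_n^3}{\left(\frac12\right)_n\left(\frac13\right)_n\left(\frac23\right)_n}\frac{(10n-3)}{n^3}\left(\frac{2}{27}\right)^{n}=\frac{\pi^2}{2},$$ $$\sum_{n=1}^{\infty}\frac{(1)_n^3}{\left(\frac12\right)_n\left(\frac13\right)_n\left(\frac23\right)_n}\frac{(11n-3)}{n^3}\left(\frac{16}{27}\right)^n=8\pi^2,$$ $$\sum_{n=1}^{\infty}(-1)^{n+1}\frac{(1)_n^3}{\left(\frac12\right)_n\left(\frac13\right)_n\left(\frac23\right)_n}\frac{(15n-4)}{n^3}\frac1{4^n}=27L_{-3}(2),$$ $$\sum_{n=1}^{\infty}(-1)^{n+1}\frac{(1)_n^3}{\left(\frac12\right)_n\left(\frac14\right)_n\left(\frac34\right)_n}\frac{(5n-1)}{n^3}\left(\frac34\right)^{2n}=\frac{45}{2}L_{-3}(2),$$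 $$\sum_{n=1}^{\infty}\frac{(1)_n^3}{\left(\frac12\right)_n\left(\frac14\right)_n\left(\frac34\right)_n}\frac{(35n-8)}{n^3}\left(\frac34\right)^{4n}=12\pi^2.$$
   Context: $(x)_n=\Gamma(x+n)/\Gamma(x)=x(x+1)\cdots(x+n-1)$. $L_k(t)=\sum_{n=1}^\infty\chi_k(n)n^{-t}$ with $\chi_k(n)=\left(\frac kn\right)$ the Jacobi (Kronecker) symbol; thus $L_{-4}(2)=1-\frac1{3^2}+\frac1{5^2}-\cdots$ is Catalan's constant and $L_{-3}(2)=1-\frac1{2^2}+\frac1{4^2}-\frac1{5^2}+\cdots$. *)

(* Defs.v *)
From Stdlib Require Import Reals ZArith List Bool.
From Coquelicot Require Import Coquelicot.
From mathcomp Require boot.prime.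

Open Scope R_scope.

(* The Pochhammer symbol (x)_n = Gamma(x+n) / Gamma(x). *)
Fixpoint poch (x : R) (n : nat) : R :=
  match n with
  | O => 1
  | S m => poch x m * (x + INR m)
  end.

(* (a/p) for p prime: the Legendre symbol when p is odd, and Kronecker's
   convention at p = 2. *)
Definition kronecker_prime (a : Z) (p : nat) : Z :=
  (if (p =? 2)%nat then
     if Z.even a then 0
     else if (a mod 8 =? 1) || (a mod 8 =? 7) then 1 else -1
   else if a mod Z.of_nat p =? 0 then 0
   else if existsb (fun x => (Z.of_nat x ^ 2 - a) mod Z.of_nat p =? 0)
             (seq 1 (p - 1)) then 1
   else -1)%Z.

(* Only non-negative lower arguments n are covered; (a/n) is the product of
   (a/p)^v_p(n) over the primes p dividing n. *)
Definition kronecker (a : Z) (n : nat) : Z :=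
  (if (n =? 0)%nat then if Z.abs a =? 1 then 1 else 0
   else fold_right Z.mul 1
          (map (fun p => kronecker_prime a p ^ Z.of_nat (prime.logn p n))
             (prime.primes n)))%Z.

Definition chi (k : Z) (n : nat) : R := IZR (kronecker k n).

(* Series is total: L k t is the Dirichlet series only where that series
   converges (absolutely for t > 1). *)
Definition L (k : Z) (t : R) : R :=
  Series (fun m => chi k (S m) * Rpower (INR (S m)) (- t)).

Definition is_sum_from_1 (a : nat -> R) (s : R) : Prop :=
  is_series (fun m => a (S m)) s.

(* Main.v *)
Require Import Defs.
From Stdlib Require Import Reals Lra Lia Psatz ZArith.
From Coquelicot Require Import Coquelicot.

Open Scope R_scope.

(** Each of the nine series is the edge n -> G(n,0) of a Wilf-Zeilberger pair, that is,
    of F and G on the quarter plane with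
      F(n+1,k) - F(n,k) = G(n,k+1) - G(n,k).
    Summing this relation over k, then over n, turns the sum of F(0,k) into the sum of
    G(n,0) - lim_k G(n,k), as soon as the row sums of F tend to 0 ([wz_telescoping]).
    A rapidly convergent series of the statement is thereby exchanged for the slow
    series of the F(0,k), which can be summed by other means.

    In all pairs F is a quotient of Gamma functions, so F is determined up to a constant
    by its two ratios F(n+1,k)/F(n,k) and F(n,k+1)/F(n,k), and G/F is a rational
    function R.  The Wilf-Zeilberger relation is then one identity of rational functions
    in n and k; neither Gamma nor integrals are needed.  Uniform bounds for the first
    ratio and for R, again rational inequalities, give the two limits
    ([hterm_acceleration]).

    The slow series are the following.
    - Sum of (-1)^k/(2k+1)^2, which is L_{-4}(2): for 4n-1, and by way of a second
      pair for (3n-1)/2^(3n).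
    - Sum of 1/(3k+1)^2 - 1/(3k+2)^2, which is L_{-3}(2): for 15n-4.
    - The expansion 2 t^2 = sum of (2 sin t)^(2m)/(m^2 binomial(2m,m)), proved by
      comparing second derivatives ([is_series_arcsin_sq]): at t = PI/2 for 10n-3 and
      11n-3, and at t = PI/3 for 35n-8.
    - Sum of 1/(k+1/2)^2 = PI^2/2, obtained from the previous expansion at PI/2 by one
      more pair: for (3n-1)/2^(2n).  Hence the sum of 1/(k+1)^2 = PI^2/6: for 21n-8.

    The series with 5n-1 needs a boundary term.  Its pair starts from a row v(l) for
    which l^2 v(l) has a limit U, and lim_l G(n,l) is U times a known sequence, whose sum is a
    multiple of U log(2+sqrt 3)/sqrt 3 ([sum_5n1_row]).  The same row is the first row
    of the pairs of [shifted_row], with parameter a = 1/3 and a = -1/3; there the edge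
    is the rational sequence 1/(k+a+1/2)^2 and the boundary is U (-1)^k/(k+a+1/2).  The
    mean of the two values of a gives the sum of 1/(6k+1)^2 - 1/(6k+5)^2, which is
    5/4 L_{-3}(2), and the same multiple of U log(2+sqrt 3)/sqrt 3.  The two boundary
    contributions cancel, so the number U is never computed.

    The Kronecker symbols of -4 and -3 are identified with the odd characters modulo 4
    and 3 by complete multiplicativity and by deciding when -4 and -3 are squares in
    the prime fields. *)

(** * Limits and sums of real series *)

Lemma is_lim_seq_0_of_le (u v : nat -> R) :
  (forall n, Rabs (u n) <= v n) -> is_lim_seq v 0 -> is_lim_seq u 0.
Proof.
intros Huv Hv.
apply is_lim_seq_abs_0.
apply (is_lim_seq_le_le (fun _ => 0) _ v).
- intros n; split; [apply Rabs_pos | apply Huv].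
- apply is_lim_seq_const.
- exact Hv.
Qed.

(** Fixes the codomain to the reals, where the generic statement leaves a normed
    module that unification must guess. *)
Lemma is_series_lim_seq (a : nat -> R) (l : R) :
  is_series a l <-> is_lim_seq (sum_n a) l.
Proof. reflexivity. Qed.

Lemma sum_n_0R (a : nat -> R) : sum_n a 0 = a O :> R.
Proof. exact (sum_O a). Qed.

Lemma sum_n_SR (a : nat -> R) (n : nat) : sum_n a (S n) = sum_n a n + a (S n) :> R.
Proof. exact (sum_Sn a n). Qed.

Lemma sum_n_ge_last (a : nat -> R) (n m : nat) :
  (forall k, a (S k) <= a k) ->
  INR m * a (n + m)%nat <= sum_n a (n + m) - sum_n a n.
Proof.
intros Hd; induction m as [|m IH].
- rewrite Nat.add_0_r; simpl; lra.
- rewrite Nat.add_succ_r, sum_Sn, S_INR; unfold plus; simpl.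
  pose proof (Hd (n + m)%nat) as H1.
  pose proof (pos_INR m).
  nra.
Qed.

(** Olivier's theorem: the block of terms between k/2 and k dominates about k/2
    copies of the last one, and such blocks tend to 0 by the Cauchy criterion. It
    makes G(n,k) tend to 0 when G is at most O(k) times a decreasing summable row. *)
Lemma summable_decreasing_o (a : nat -> R) :
  (forall k, 0 <= a k) -> (forall k, a (S k) <= a k) -> ex_series a ->
  is_lim_seq (fun k => (INR k + 1) * a k) 0.
Proof.
intros Hp Hd [l Hl].
apply is_lim_seq_spec; intros eps.
assert (He : 0 < eps / 8) by (destruct eps; simpl; lra).
assert (Hl' : is_lim_seq (sum_n a) l) by exact Hl.
destruct (proj2 (is_lim_seq_spec _ _) Hl' (mkposreal _ He)) as [N HN].
simpl in HN.
exists (2 * N + 2)%nat; intros k Hk.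
pose proof (Nat.div_mod k 2 ltac:(lia)) as Ek.
pose proof (Nat.mod_upper_bound k 2 ltac:(lia)) as Em.
set (n := (k / 2)%nat) in *; set (r := (k mod 2)%nat) in *.
assert (Ek' : k = (n + (n + r))%nat) by lia.
pose proof (sum_n_ge_last a n (n + r) Hd) as H1; rewrite <- Ek' in H1.
pose proof (HN n ltac:(lia)) as H2; pose proof (HN k ltac:(lia)) as H3.
apply Rabs_def2 in H2; apply Rabs_def2 in H3.
pose proof (Hp k) as H4.
assert (H5 : INR k + 1 <= 3 * INR (n + r)).
{ replace 3 with (INR 3) by (simpl; lra).
  rewrite <- mult_INR, <- S_INR; apply le_INR; lia. }
rewrite Rminus_0_r, Rabs_pos_eq by (pose proof (pos_INR k); nra).
nra.
Qed.

(** Dominated convergence for series. *)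
Lemma tannery (f : nat -> nat -> R) (b : nat -> R) :
  (forall n k, Rabs (f n k) <= b k) -> ex_series b ->
  (forall k, is_lim_seq (fun n => f n k) 0) ->
  is_lim_seq (fun n => Series (f n)) 0.
Proof.
intros Hb Hs H0.
assert (Hf : forall n, ex_series (fun k => Rabs (f n k))).
{ intros n; apply (ex_series_le (K := R_AbsRing) (V := R_CompleteNormedModule)
    _ b); [|exact Hs].
  intros k; unfold norm; simpl; unfold abs; simpl; rewrite Rabs_Rabsolu; apply Hb. }
apply is_lim_seq_spec; intros eps.
assert (He : 0 < eps / 2) by (destruct eps; simpl; lra).
destruct (Hs : exists l : R, is_series b l) as [l Hl].
assert (Hl' : is_lim_seq (sum_n b) l) by exact Hl.
destruct (proj2 (is_lim_seq_spec _ _) Hl' (mkposreal _ He)) as [K HK]; simpl in HK.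
specialize (HK K (le_n K)).
assert (HF : is_lim_seq (fun n => sum_n (fun k => Rabs (f n k)) K) 0).
{ clear HK; induction K as [|K IH].
  - apply (is_lim_seq_ext (fun n => Rabs (f n O))).
    + intros n; now rewrite sum_O.
    + apply -> is_lim_seq_abs_0; apply H0.
  - apply (is_lim_seq_ext (fun n => sum_n (fun k => Rabs (f n k)) K + Rabs (f n (S K)))).
    + intros n; now rewrite sum_Sn.
    + replace (Finite 0) with (Finite (0 + 0)) by (f_equal; lra).
      apply is_lim_seq_plus'; [exact IH | apply -> is_lim_seq_abs_0; apply H0]. }
destruct (proj2 (is_lim_seq_spec _ _) HF (mkposreal _ He)) as [N HN]; simpl in HN.
exists N; intros n Hn; specialize (HN n Hn).
rewrite Rminus_0_r in *.
eapply Rle_lt_trans; [apply Series_Rabs, Hf|].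
rewrite (Series_incr_n _ (S K)) by (auto with arith || apply Hf).
simpl pred; rewrite <- sum_n_Reals.
assert (Ht : Series (fun k => Rabs (f n (S K + k)%nat)) <= l - sum_n b K).
{ assert (Hb' : is_series (fun k => b (S K + k)%nat) (l - sum_n b K)).
  { pose proof (is_series_incr_n b (S K) (l - sum_n b K) ltac:(lia)) as Hi.
    apply Hi; change (Init.Nat.pred (S K)) with K.
    match goal with |- is_series _ ?x => change x with ((l - sum_n b K) + sum_n b K) end;
    replace (l - sum_n b K + sum_n b K) with l by ring.
    exact Hl. }
  rewrite <- (is_series_unique _ _ Hb').
  apply Series_le; [|now exists (l - sum_n b K)].
  intros k; split; [apply Rabs_pos | apply Hb]. }
apply Rabs_def2 in HN; apply Rabs_def2 in HK. lra.
Qed.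

(** The sum of row n+1 of F is that of row n plus c(n) - G(n,0); iterating, the
    partial sums on the left are s minus the sum of row n+1. The limits c(n) stay
    inside the summand because in [shifted_row] they are summable only
    conditionally. *)
Lemma wz_telescoping (F G : nat -> nat -> R) (s : R) (c : nat -> R) :
  (forall n k, F (S n) k - F n k = G n (S k) - G n k) ->
  is_series (F O) s ->
  (forall n, is_lim_seq (G n) (c n)) ->
  is_lim_seq (fun n => Series (F n)) 0 ->
  is_series (fun n => G n O - c n) s.
Proof.
intros HW H0 HG HS.
assert (Hstep : forall n (sn : R), is_series (F n) sn ->
                 is_series (F (S n)) (sn - (G n O - c n))).
{ intros n sn Hn; apply is_series_lim_seq.
  apply (is_lim_seq_ext (fun K => sum_n (F n) K + (G n (S K) - G n O))).
  - intros K; induction K as [|K IH].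
    + rewrite !sum_n_0R; pose proof (HW n O); lra.
    + rewrite !sum_n_SR, <- IH; pose proof (HW n (S K)); lra.
  - replace (sn - (G n O - c n)) with (sn + (c n - G n O)) by ring.
    apply is_lim_seq_plus'; [exact Hn|].
    apply is_lim_seq_minus'; [|apply is_lim_seq_const].
    apply is_lim_seq_incr_1 with (u := G n), HG. }
assert (Hall : forall n, is_series (F (S n)) (s - sum_n (fun i => G i O - c i) n)).
{ induction n as [|n IH].
  - rewrite sum_n_0R; apply Hstep, H0.
  - rewrite sum_n_SR.
    replace (s - _) with (s - sum_n (fun i => G i O - c i) n - (G (S n) O - c (S n))) by ring.
    apply Hstep, IH. }
apply is_series_lim_seq.
apply (is_lim_seq_ext (fun n => s - Series (F (S n)))).
- intros n; rewrite (is_series_unique _ _ (Hall n)); ring.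
- replace (Finite s) with (Finite (s - 0)) by (f_equal; ring).
  apply is_lim_seq_minus'; [apply is_lim_seq_const|].
  apply is_lim_seq_incr_1 with (u := fun n => Series (F n)), HS.
Qed.

Lemma is_series_scalR (c : R) (a : nat -> R) (l : R) :
  is_series a l -> is_series (fun n => c * a n) (c * l).
Proof. exact (is_series_scal_l (K := R_AbsRing) c a l). Qed.

Lemma ex_series_scalR (c : R) (a : nat -> R) :
  ex_series a -> ex_series (fun n => c * a n).
Proof. intros [l Hl]; exists (c * l); now apply is_series_scalR. Qed.

Lemma ex_series_leR (a b : nat -> R) :
  (forall n, Rabs (a n) <= b n) -> ex_series b -> ex_series a.
Proof. exact (ex_series_le (K := R_AbsRing) (V := R_CompleteNormedModule) a b). Qed.

Lemma is_series_extR (a b : nat -> R) (l : R) :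
  (forall n, a n = b n) -> is_series a l -> is_series b l.
Proof. exact (is_series_ext a b l). Qed.

Lemma is_series_plusR (a b : nat -> R) (la lb : R) :
  is_series a la -> is_series b lb -> is_series (fun n => a n + b n) (la + lb).
Proof. exact (is_series_plus (K := R_AbsRing) a b la lb). Qed.

Lemma is_series_uniq (a : nat -> R) (l1 l2 : R) :
  is_series a l1 -> is_series a l2 -> l1 = l2.
Proof.
intros H1 H2; now rewrite <- (is_series_unique _ _ H1), <- (is_series_unique _ _ H2).
Qed.

Lemma is_derive_extR (f g : R -> R) (x l : R) :
  (forall t, f t = g t) -> is_derive f x l -> is_derive g x l.
Proof. exact (is_derive_ext f g x l). Qed.

Lemma is_lim_seq_inv_shift (a : R) : 0 < a ->
  is_lim_seq (fun n => / (INR n + a)) 0.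
Proof.
intros Ha.
replace (Finite 0) with (Rbar_inv p_infty) by reflexivity.
apply is_lim_seq_inv; [|discriminate].
eapply is_lim_seq_plus; [apply is_lim_seq_INR | apply is_lim_seq_const | reflexivity].
Qed.

Lemma is_series_group2 (a : nat -> R) (l : R) :
  is_series a l -> is_series (fun k => a (2 * k)%nat + a (2 * k + 1)%nat) l.
Proof.
intros H; apply is_series_lim_seq in H; apply is_series_lim_seq.
apply (is_lim_seq_ext (fun n => sum_n a (2 * n + 1))).
- induction n as [|n IH].
  + simpl (2 * 0 + 1)%nat; rewrite sum_n_SR, !sum_n_0R; reflexivity.
  + replace (2 * S n + 1)%nat with (S (S (2 * n + 1))) by lia.
    rewrite !sum_n_SR, IH; replace (S (2 * n + 1)) with (2 * S n)%nat by lia.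
    replace (S (2 * S n)) with (2 * S n + 1)%nat by lia. apply Rplus_assoc.
- apply (is_lim_seq_subseq (sum_n a) l (fun n => (2 * n + 1)%nat)); [|exact H].
  apply eventually_subseq; intros; lia.
Qed.

Lemma is_series_group3 (a : nat -> R) (l : R) :
  is_series a l ->
  is_series (fun k => a (3 * k)%nat + a (3 * k + 1)%nat + a (3 * k + 2)%nat) l.
Proof.
intros H; apply is_series_lim_seq in H; apply is_series_lim_seq.
apply (is_lim_seq_ext (fun n => sum_n a (3 * n + 2))).
- induction n as [|n IH].
  + simpl (3 * 0 + 2)%nat; rewrite !sum_n_SR, !sum_n_0R; reflexivity.
  + replace (3 * S n + 2)%nat with (S (S (S (3 * n + 2)))) by lia.
    rewrite !sum_n_SR, IH; replace (S (3 * n + 2)) with (3 * S n)%nat by lia.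
    replace (S (3 * S n)) with (3 * S n + 1)%nat by lia.
    replace (S (3 * S n + 1)) with (3 * S n + 2)%nat by lia.
    rewrite !Rplus_assoc; reflexivity.
- apply (is_lim_seq_subseq (sum_n a) l (fun n => (3 * n + 2)%nat)); [|exact H].
  apply eventually_subseq; intros; lia.
Qed.

Lemma ex_series_telescoping (u : nat -> R) :
  is_lim_seq u 0 -> ex_series (fun k => u k - u (S k)).
Proof.
intros Hu; exists (u O); apply is_series_lim_seq.
apply (is_lim_seq_ext (fun n => u O - u (S n))).
- induction n as [|n IH].
  + now rewrite sum_n_0R.
  + rewrite sum_n_SR, <- IH; ring.
- replace (Finite (u O)) with (Finite (u O - 0)) by (f_equal; ring).
  apply is_lim_seq_minus'; [apply is_lim_seq_const|].
  now apply (is_lim_seq_incr_1 u).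
Qed.

Lemma ex_series_inv_sq (a : R) : 0 < a -> ex_series (fun k => / (INR k + a) ^ 2).
Proof.
intros Ha.
pose proof (ex_series_telescoping (fun n => / (INR n + a)) (is_lim_seq_inv_shift a Ha)) as H.
apply (ex_series_leR _ (fun k => (1 + / a) * (/ (INR k + a) - / (INR (S k) + a))));
  [|now apply ex_series_scalR].
intros k; rewrite S_INR; pose proof (pos_INR k) as Hk.
rewrite Rabs_pos_eq by (apply Rlt_le, Rinv_0_lt_compat, pow_lt; lra).
apply Rminus_le_0.
replace (_ - _) with (INR k / (a * (INR k + a) ^ 2 * (INR k + 1 + a))) by (field; lra).
apply Rle_mult_inv_pos; [lra|]. repeat apply Rmult_lt_0_compat; lra.
Qed.

Lemma ex_series_abs (b : nat -> R) (s : R) :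
  (forall k, 0 <= b k) -> is_series b s -> ex_series (fun k => Rabs (b k)).
Proof.
intros Hb Hs; exists s; apply (is_series_extR b); [|exact Hs].
intros k; now rewrite Rabs_pos_eq.
Qed.

(** * Hypergeometric Wilf-Zeilberger pairs *)

Fixpoint prodR (f : nat -> R) (n : nat) : R :=
  match n with O => 1 | S m => prodR f m * f m end.

Lemma prodR_pos (f : nat -> R) (n : nat) :
  (forall i, 0 <= f i) -> 0 <= prodR f n.
Proof.
intros Hf; induction n as [|n IH]; simpl; [lra|].
apply Rmult_le_pos; auto.
Qed.

(** The comparison product behaves like n^(-1/2): the square of (n+3)/(n+7/2) is at
    most (n+3)/(n+4), whose products telescope. This rate is as slow as the pairs
    with alternating base require, while a geometric bound below 6/7 is also
    covered. *)
Lemma prodR_to_0 (rho : nat -> R) (n0 : nat) :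
  (forall n, 0 <= rho n) ->
  (forall n, (n0 <= n)%nat -> rho n <= (2 * INR n + 6) / (2 * INR n + 7)) ->
  is_lim_seq (prodR rho) 0.
Proof.
intros Hp Hr.
assert (HC : forall n, (n0 <= n)%nat ->
  prodR rho n ^ 2 * (INR n + 3) <= prodR rho n0 ^ 2 * (INR n0 + 3)).
{ induction 1 as [|n Hn IH]; [lra|].
  cbn [prodR]; rewrite S_INR.
  pose proof (Hp n) as H1; pose proof (Hr n Hn) as H2; pose proof (pos_INR n) as H3.
  assert (H4 : rho n ^ 2 * (INR n + 4) <= INR n + 3).
  { assert (H5 : rho n * (INR n + 7/2) <= INR n + 3).
    { apply Rle_div_r in H2; lra. }
    assert (H6 : (rho n * (INR n + 7/2)) ^ 2 <= (INR n + 3) ^ 2)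
      by (apply pow_incr; split; [apply Rmult_le_pos|]; lra).
    apply Rmult_le_reg_r with (INR n + 3); [lra|].
    pose proof (pow2_ge_0 (rho n)) as H7.
    replace ((INR n + 3) * (INR n + 3)) with ((INR n + 3) ^ 2) by ring.
    eapply Rle_trans; [|exact H6]. nra. }
  eapply Rle_trans; [|exact IH].
  replace ((prodR rho n * rho n) ^ 2 * (INR n + 1 + 3))
    with (prodR rho n ^ 2 * (rho n ^ 2 * (INR n + 4))) by ring.
  apply Rmult_le_compat_l; [apply pow2_ge_0 | exact H4]. }
set (C := prodR rho n0 ^ 2 * (INR n0 + 3)) in *.
assert (HL : is_lim_seq (fun n => C * / (INR n + 3)) 0).
{ replace (Finite 0) with (Rbar_mult C 0) by (simpl; now rewrite Rmult_0_r).
  apply is_lim_seq_scal_l, is_lim_seq_inv_shift; lra. }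
apply is_lim_seq_spec; intros eps.
assert (He : 0 < eps * eps) by (apply Rmult_lt_0_compat; apply cond_pos).
destruct (proj2 (is_lim_seq_spec _ _) HL (mkposreal _ He)) as [N HN]; simpl in HN.
exists (N + n0)%nat; intros n Hn.
specialize (HN n ltac:(lia)); specialize (HC n ltac:(lia)).
pose proof (prodR_pos rho n Hp) as H1; pose proof (pos_INR n) as H2.
rewrite Rminus_0_r in *; rewrite Rabs_pos_eq by exact H1.
apply Rabs_def2 in HN; destruct HN as [HN _].
assert (H3 : prodR rho n ^ 2 <= C * / (INR n + 3)) by (apply (Rle_div_r _ C (INR n + 3)); lra).
destruct (Rlt_or_le (prodR rho n) eps) as [|H4]; [assumption|].
pose proof (cond_pos eps). nra.
Qed.

(** The term with prescribed ratios rn in n and rk in k and value 1 at the origin: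
    first down the column k = 0, then along row n. It stands for a quotient of Gamma
    functions. *)
Definition hterm (rn rk : R -> R -> R) (n k : nat) : R :=
  prodR (fun i => rn (INR i) 0) n * prodR (fun j => rk (INR n) (INR j)) k.

Lemma hterm_Sk rn rk n k : hterm rn rk n (S k) = rk (INR n) (INR k) * hterm rn rk n k.
Proof. unfold hterm; cbn [prodR]; ring. Qed.

(** Equality of the two ways round a unit square: the condition for rn and rk to be
    the ratios of one function of two variables. *)
Definition compatible (rn rk : R -> R -> R) : Prop :=
  forall n k : nat, rn (INR n) (INR k + 1) * rk (INR n) (INR k)
                  = rk (INR n + 1) (INR k) * rn (INR n) (INR k).

(** The Wilf-Zeilberger relation for G = Rt F, divided by F(n,k). *)
Definition certified (rn rk Rt : R -> R -> R) : Prop :=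
  forall n k : nat, rn (INR n) (INR k) - 1
    = Rt (INR n) (INR k + 1) * rk (INR n) (INR k) - Rt (INR n) (INR k).

Lemma hterm_Sn rn rk n k :
  compatible rn rk ->
  hterm rn rk (S n) k = rn (INR n) (INR k) * hterm rn rk n k.
Proof.
intros Hc; induction k as [|k IH].
- unfold hterm; simpl; ring.
- rewrite !hterm_Sk, IH, !S_INR.
  rewrite <- !Rmult_assoc, <- Hc; ring.
Qed.

Lemma hterm_le_row0 rn rk (rho : nat -> R) :
  compatible rn rk ->
  (forall n k : nat, Rabs (rn (INR n) (INR k)) <= rho n) ->
  forall n k, Rabs (hterm rn rk n k) <= prodR rho n * Rabs (hterm rn rk 0 k).
Proof.
intros Hc Hr n k; induction n as [|n IH].
- simpl; lra.
- rewrite hterm_Sn, Rabs_mult by exact Hc; cbn [prodR].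
  rewrite (Rmult_comm (prodR rho n)), Rmult_assoc.
  apply Rmult_le_compat; auto using Rabs_pos.
Qed.

Lemma hterm_row0 rn rk (b : nat -> R) :
  (forall k : nat, b (S k) = rk 0 (INR k) * b k) ->
  forall k, b O * hterm rn rk 0 k = b k.
Proof.
intros Hb k; induction k as [|k IH].
- unfold hterm; simpl; ring.
- rewrite hterm_Sk, Hb, <- IH; simpl INR; ring.
Qed.

Lemma hterm_wz rn rk Rt n k :
  compatible rn rk ->
  certified rn rk Rt ->
  hterm rn rk (S n) k - hterm rn rk n k
  = Rt (INR n) (INR (S k)) * hterm rn rk n (S k) - Rt (INR n) (INR k) * hterm rn rk n k.
Proof.
intros Hc Hw.
rewrite hterm_Sn, hterm_Sk, S_INR by exact Hc.
transitivity ((rn (INR n) (INR k) - 1) * hterm rn rk n k); [ring|].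
rewrite Hw; ring.
Qed.

Lemma hterm_Series_to_0 rn rk (rho : nat -> R) (n0 : nat) :
  compatible rn rk ->
  (forall n k : nat, Rabs (rn (INR n) (INR k)) <= rho n) ->
  (forall n, (n0 <= n)%nat -> rho n <= (2 * INR n + 6) / (2 * INR n + 7)) ->
  ex_series (fun k => Rabs (hterm rn rk 0 k)) ->
  is_lim_seq (fun n => Series (hterm rn rk n)) 0.
Proof.
intros Hc Hr Hr0 Hs.
assert (Hp : forall n, 0 <= rho n)
  by (intros n; eapply Rle_trans; [apply Rabs_pos | apply (Hr n O)]).
apply is_lim_seq_0_of_le with
  (v := fun n => prodR rho n * Series (fun k => Rabs (hterm rn rk 0 k))).
- intros n.
  assert (He : ex_series (fun k => prodR rho n * Rabs (hterm rn rk 0 k)))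
    by now apply ex_series_scalR.
  assert (Ha : ex_series (fun k => Rabs (hterm rn rk n k))).
  { apply (ex_series_leR _ (fun k => prodR rho n * Rabs (hterm rn rk 0 k))); [|exact He].
    intros k; rewrite Rabs_Rabsolu.
    now apply hterm_le_row0. }
  eapply Rle_trans; [now apply Series_Rabs|].
  rewrite <- Series_scal_l.
  apply Series_le; [|exact He].
  intros k; split; [apply Rabs_pos | now apply hterm_le_row0].
- replace (Finite 0) with (Rbar_mult 0 (Series (fun k => Rabs (hterm rn rk 0 k))))
    by (simpl; now rewrite Rmult_0_l).
  apply is_lim_seq_scal_r, (prodR_to_0 _ n0); assumption.
Qed.

(** Here F(0,k) = b(k) and G(n,0) = t(n), both known through their ratios only, so
    that they need not be written with Gamma functions. The bound on rn makes row n
    of F at most a null sequence times |b|. The sequence |b| is summable and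
    decreasing, so k b(k) -> 0, and the linear growth allowed for Rt still gives
    G(n,k) -> 0. *)
Theorem hterm_acceleration (rn rk Rt : R -> R -> R) (b t : nat -> R) (s : R) :
  compatible rn rk ->
  certified rn rk Rt ->
  (forall n k : nat, Rabs (rn (INR n) (INR k)) <= (2 * INR n + 6) / (2 * INR n + 7)) ->
  (forall n k : nat, Rabs (Rt (INR n) (INR k)) <= 3 * (INR k + 1)) ->
  (forall k : nat, b (S k) = rk 0 (INR k) * b k) ->
  (forall n k : nat, Rabs (rk (INR n) (INR k)) <= 1) ->
  ex_series (fun k => Rabs (b k)) ->
  (forall n : nat, Rt (INR n) 0 <> 0) ->
  (forall n : nat, t (S n) * Rt (INR n) 0 = t n * rn (INR n) 0 * Rt (INR n + 1) 0) ->
  t O = Rt 0 0 * b O ->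
  is_series b s -> is_series t s.
Proof.
intros Hc Hw Hr HR Hb Hk Ha Hn0 Ht Ht0 Hs.
(* b = b(0) F(0,.) with F(0,0) = 1, so b(0) has to be divided out *)
destruct (Req_dec (b O) 0) as [Hz|Hz].
{   assert (Hbz : forall k, b k = 0) by (induction k; [exact Hz | rewrite Hb, IHk; ring]).
  assert (Htz : forall k, t k = 0).
  { induction k as [|k IH]; [rewrite Ht0, Hz; ring|].
    apply Rmult_eq_reg_r with (Rt (INR k) 0); [|apply Hn0]. rewrite Ht, IH; ring. }
  apply (is_series_ext b); [|exact Hs]. intros k; now rewrite Hbz, Htz. }
pose proof (hterm_row0 rn rk b Hb) as HB.
assert (Hah : ex_series (fun k => Rabs (hterm rn rk 0 k))).
{ destruct (Ha : exists l : R, is_series (fun k => Rabs (b k)) l) as [l Hl].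
  exists (/ Rabs (b O) * l).
  apply (is_series_extR (fun k => / Rabs (b O) * Rabs (b k))); [|now apply is_series_scalR].
  intros k; rewrite <- (HB k), Rabs_mult; field; now apply Rabs_no_R0. }
assert (Hlim : forall n, is_lim_seq (fun k => Rt (INR n) (INR k) * hterm rn rk n k) 0).
{ intros n.
  apply is_lim_seq_0_of_le with
    (v := fun k => (3 * prodR (fun n => (2 * INR n + 6) / (2 * INR n + 7)) n)
                   * ((INR k + 1) * Rabs (hterm rn rk 0 k))).
  - intros k; rewrite Rabs_mult.
    pose proof (pos_INR k).
    apply Rle_trans with ((3 * (INR k + 1)) *
      (prodR (fun n => (2 * INR n + 6) / (2 * INR n + 7)) n * Rabs (hterm rn rk 0 k))); [|apply Req_le; ring].
    apply Rmult_le_compat; auto using Rabs_pos.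
    apply (hterm_le_row0 rn rk _ Hc Hr).
  - match goal with |- is_lim_seq (fun k => ?c * _) _ =>
      replace (Finite 0) with (Rbar_mult c 0) by (simpl; now rewrite Rmult_0_r) end.
    apply is_lim_seq_scal_l, summable_decreasing_o; [intros; apply Rabs_pos| |exact Hah].
    intros k; rewrite hterm_Sk, Rabs_mult.
    pose proof (Rabs_pos (hterm rn rk 0 k)); pose proof (Hk O k). nra. }
assert (HT : forall n, b O * (Rt (INR n) 0 * hterm rn rk n 0) = t n).
{ induction n as [|n IH].
  - rewrite Ht0; unfold hterm; simpl; ring.
  - apply Rmult_eq_reg_r with (Rt (INR n) 0); [|apply Hn0].
    rewrite Ht, <- IH, hterm_Sn, S_INR by exact Hc. simpl (INR 0). ring. }
apply (is_series_extR (fun n => b O * (Rt (INR n) 0 * hterm rn rk n 0 - 0)));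
  [intros n; rewrite Rminus_0_r; apply HT|].
replace s with (b O * (/ b O * s)) by (field; exact Hz).
apply is_series_scalR.
apply (wz_telescoping (hterm rn rk) (fun n k => Rt (INR n) (INR k) * hterm rn rk n k)
         (/ b O * s) (fun _ => 0)).
- intros n k; now apply hterm_wz.
- apply (is_series_extR (fun k => / b O * b k)).
  + intros k; rewrite <- (HB k); field; exact Hz.
  + now apply is_series_scalR.
- exact Hlim.
- apply (hterm_Series_to_0 rn rk (fun n => (2 * INR n + 6) / (2 * INR n + 7)) 0); auto.
  intros; apply Rle_refl.
Qed.

(** * Rational identities and inequalities in the quarter plane *)

Lemma Rabs_div_le (N D N' D' : R) :
  0 <= N -> 0 < D -> 0 < D' -> 0 <= N' * D - N * D' -> Rabs (N / D) <= N' / D'.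
Proof.
intros HN HD HD' H.
rewrite Rabs_pos_eq by (apply Rle_mult_inv_pos; assumption).
apply Rle_div_l; [assumption|].
unfold Rdiv; rewrite (Rmult_comm N'), Rmult_assoc, Rmult_comm.
apply Rle_div_r; lra.
Qed.

Lemma Rabs_div_le_const (N D c : R) :
  0 <= N -> 0 < D -> 0 <= c * D - N -> Rabs (N / D) <= c.
Proof.
intros HN HD H. rewrite Rabs_pos_eq by (apply Rle_mult_inv_pos; assumption).
apply Rle_div_l; lra.
Qed.

(** Closes goals 0 <= p for p a sum of monomials with nonnegative coefficients in
    nonnegative variables; all inequalities between rational functions below become
    of this shape once expanded. *)
Ltac poly_nonneg :=
  repeat first
    [ lra | assumption
    | apply Rplus_le_le_0_compat | apply Rmult_le_pos | apply pow_le ].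
Ltac poly_pos :=
  repeat first [ lra | apply Rmult_lt_0_compat | apply pow_lt ].
Ltac nonneg_vars n k :=
  let Hx := fresh "Hx" in let Hy := fresh "Hy" in
  pose proof (pos_INR n) as Hx; pose proof (pos_INR k) as Hy;
  let x := fresh "x" in let y := fresh "y" in
  set (x := INR n) in *; set (y := INR k) in *; clearbody x y.
Ltac field_pos := field; repeat split; apply Rgt_not_eq; poly_pos.
Ltac rat_identity := let n := fresh in let k := fresh in
  intros n k; nonneg_vars n k; field_pos.
Ltac rat_bound := let n := fresh in let k := fresh in
  intros n k; nonneg_vars n k; rewrite ?Rabs_Ropp;
  first [ apply Rabs_div_le; [poly_nonneg | poly_pos | poly_pos | ring_simplify; poly_nonneg]
        | apply Rabs_div_le_const; [poly_nonneg | poly_pos | ring_simplify; poly_nonneg] ].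
Ltac rat_nonzero := let n := fresh in intros n; nonneg_vars n n;
  apply Rgt_not_eq, Rdiv_lt_0_compat; [|poly_pos];
  first [ solve [poly_pos]
        | ring_simplify; apply Rplus_le_lt_0_compat; [poly_nonneg | lra] ].

Ltac check_hterm rn rk Rt b :=
  apply (hterm_acceleration rn rk Rt b); unfold rn, rk, Rt;
  [ rat_identity | rat_identity | rat_bound | rat_bound | | rat_bound | | rat_nonzero | | ].

(** * The power series of the squared arcsine *)

Lemma nonneg_of_derive_nonneg (f f' : R -> R) (a : R) :
  f 0 = 0 ->
  (forall t, 0 <= t <= a -> is_derive f t (f' t)) ->
  (forall t, 0 <= t <= a -> 0 <= f' t) ->
  forall t, 0 <= t <= a -> 0 <= f t.
Proof.
intros H0 Hd Hp t Ht.
destruct (MVT_gen f 0 t f') as [c [Hc E]].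
- intros x Hx; rewrite Rmin_left, Rmax_right in Hx by lra. apply Hd; lra.
- intros x Hx; rewrite Rmin_left, Rmax_right in Hx by lra.
  apply continuity_pt_filterlim, (ex_derive_continuous f); exists (f' x); apply Hd; lra.
- rewrite Rmin_left, Rmax_right in Hc by lra.
  pose proof (Hp c ltac:(lra)). nra.
Qed.

Lemma le_of_derive_le (f g f' g' : R -> R) (a : R) :
  f 0 = g 0 ->
  (forall t, 0 <= t <= a -> is_derive f t (f' t)) ->
  (forall t, 0 <= t <= a -> is_derive g t (g' t)) ->
  (forall t, 0 <= t <= a -> f' t <= g' t) ->
  forall t, 0 <= t <= a -> f t <= g t.
Proof.
intros H0 Hf Hg Hp t Ht.
pose proof (nonneg_of_derive_nonneg (fun t => g t - f t) (fun t => g' t - f' t) a) as H.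
simpl in H.
enough (0 <= g t - f t) by lra.
apply H; [lra| | |exact Ht].
- intros u Hu. apply (is_derive_minus g f u (g' u) (f' u)); auto.
- intros u Hu; specialize (Hp u Hu); lra.
Qed.

(** Equal to 4^m/(m^2 binomial(2m,m)) with m = k+1. *)
Definition arcsin_sq_coef (k : nat) : R :=
  2 * prodR (fun j => (INR j + 1) ^ 2 / ((INR j + 3/2) * (INR j + 2))) k.

(** The remainder of 2 t^2 after N terms, given with its derivative as recursive
    functions so that differentiation is an induction on N. *)
Fixpoint arcsin_sq_rem (N : nat) (t : R) : R :=
  match N with
  | O => 2 * t ^ 2
  | S m => arcsin_sq_rem m t - arcsin_sq_coef m * sin t ^ (2 * m + 2)
  end.

Fixpoint arcsin_sq_rem' (N : nat) (t : R) : R :=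
  match N with
  | O => 4 * t
  | S m => arcsin_sq_rem' m t
           - arcsin_sq_coef m * (INR (2 * m + 2) * sin t ^ (2 * m + 1) * cos t)
  end.

(** The factor of sin^(2N) in the second derivative of the N-th remainder. *)
Definition arcsin_sq_lead (N : nat) : R :=
  arcsin_sq_coef N * ((2 * INR N + 2) * (2 * INR N + 1)).

Lemma arcsin_sq_coef_pos k : 0 < arcsin_sq_coef k.
Proof.
unfold arcsin_sq_coef; induction k as [|k IH]; cbn [prodR]; [lra|].
rewrite <- Rmult_assoc; apply Rmult_lt_0_compat; [exact IH|].
pose proof (pos_INR k).
apply Rdiv_lt_0_compat; [apply pow_lt; lra | apply Rmult_lt_0_compat; lra].
Qed.

Lemma arcsin_sq_lead_S N :
  arcsin_sq_lead (S N) = arcsin_sq_coef N * (2 * INR N + 2) ^ 2.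
Proof.
unfold arcsin_sq_lead, arcsin_sq_coef; cbn [prodR]; rewrite S_INR.
pose proof (pos_INR N); field; lra.
Qed.

Lemma is_derive_arcsin_sq_rem N t :
  is_derive (arcsin_sq_rem N) t (arcsin_sq_rem' N t).
Proof.
induction N as [|N IH]; cbn [arcsin_sq_rem arcsin_sq_rem'].
- auto_derive; [trivial|ring].
- apply (is_derive_minus (arcsin_sq_rem N) (fun t => arcsin_sq_coef N * sin t ^ (2 * N + 2)));
    [exact IH|].
  apply (is_derive_scal (fun t => sin t ^ (2 * N + 2))).
  replace (INR (2 * N + 2) * sin t ^ (2 * N + 1) * cos t)
    with (INR (2 * N + 2) * cos t * sin t ^ pred (2 * N + 2))
    by (replace (pred (2 * N + 2)) with (2 * N + 1)%nat by lia; ring).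
  apply is_derive_pow, is_derive_sin.
Qed.

(** The second derivative of sin^(2N+2) is (2N+2)(2N+1) sin^(2N) - (2N+2)^2
    sin^(2N+2). The coefficients are such that its first term cancels what the
    previous remainder left, so that a single power of the sine survives. *)
Lemma is_derive_arcsin_sq_rem' N t :
  is_derive (arcsin_sq_rem' N) t (arcsin_sq_lead N * sin t ^ (2 * N)).
Proof.
induction N as [|N IH]; cbn [arcsin_sq_rem'].
- unfold arcsin_sq_lead, arcsin_sq_coef; simpl; auto_derive; [trivial|ring].
- match goal with |- is_derive _ _ ?l => replace l with
    (arcsin_sq_lead N * sin t ^ (2 * N)
     - arcsin_sq_coef N * (INR (2 * N + 2) * (INR (2 * N + 1) * cos t * sin t ^ (2 * N)) * cos t
         + INR (2 * N + 2) * sin t ^ (2 * N + 1) * (- sin t))) end.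
  + apply (is_derive_minus (arcsin_sq_rem' N) (fun t => arcsin_sq_coef N *
       (INR (2 * N + 2) * sin t ^ (2 * N + 1) * cos t))); [exact IH|].
    apply (is_derive_scal (fun t => INR (2 * N + 2) * sin t ^ (2 * N + 1) * cos t)).
    apply (is_derive_mult (fun t => INR (2 * N + 2) * sin t ^ (2 * N + 1)) cos);
      [ | apply is_derive_cos | intros; apply Rmult_comm].
    apply (is_derive_scal (fun t => sin t ^ (2 * N + 1))).
    replace (sin t ^ (2 * N)) with (sin t ^ pred (2 * N + 1)) by (f_equal; lia).
    apply is_derive_pow, is_derive_sin.
  + rewrite arcsin_sq_lead_S; unfold arcsin_sq_lead.
    replace (2 * S N)%nat with (S (S (2 * N))) by lia.
    replace (2 * N + 1)%nat with (S (2 * N)) by lia.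
    replace (2 * N + 2)%nat with (S (S (2 * N))) by lia.
    rewrite !S_INR, mult_INR; simpl (INR 2); rewrite <- !tech_pow_Rmult.
    assert (E : cos t ^ 2 = 1 - sin t ^ 2)
      by (pose proof (sin2_cos2 t) as E; unfold Rsqr in E; simpl; lra).
    transitivity (arcsin_sq_coef N * ((2 * INR N + 2) * (2 * INR N + 1)) * sin t ^ (2 * N)
       * (1 - cos t ^ 2) + arcsin_sq_coef N * (2 * INR N + 2) * sin t ^ (2 * N) * sin t ^ 2);
      [ring | rewrite E; ring].
Qed.

(** Two integrations from 0 of 0 <= second derivative <= its value at t, the sine
    being increasing up to PI/2. *)
Lemma arcsin_sq_rem_bounds N t : 0 <= t <= PI / 2 ->
  0 <= arcsin_sq_rem N t <= arcsin_sq_lead N * (sin t ^ 2) ^ N * t ^ 2.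
Proof.
intros Ht.
assert (Hsin : forall u, 0 <= u <= t -> 0 <= sin u <= sin t).
{ intros u Hu; pose proof PI_RGT_0; split; [apply sin_ge_0; lra|].
  destruct (Req_dec u t) as [->|]; [lra|].
  apply Rlt_le, sin_increasing_1; lra. }
assert (Hl : 0 <= arcsin_sq_lead N).
{ unfold arcsin_sq_lead; pose proof (arcsin_sq_coef_pos N); pose proof (pos_INR N).
  apply Rmult_le_pos; [lra|]; nra. }
set (c := arcsin_sq_lead N * (sin t ^ 2) ^ N).
assert (Hc : forall u, 0 <= u <= t -> 0 <= arcsin_sq_lead N * sin u ^ (2 * N) <= c).
{ intros u Hu; destruct (Hsin u Hu) as [H1 H2]; split.
  - apply Rmult_le_pos; [exact Hl | now apply pow_le].
  - unfold c; rewrite <- pow_mult.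
    apply Rmult_le_compat_l; [exact Hl|]. apply pow_incr; lra. }
assert (H0 : arcsin_sq_rem N 0 = 0 /\ arcsin_sq_rem' N 0 = 0).
{ clear; induction N as [|N [I1 I2]]; cbn [arcsin_sq_rem arcsin_sq_rem'].
  - split; ring.
  - rewrite I1, I2, sin_0, !pow_i by lia; split; ring. }
destruct H0 as [H00 H01].
assert (Hd1 : forall u, 0 <= u <= t -> 0 <= arcsin_sq_rem' N u <= c * u).
{ intros u Hu; split.
  - apply (nonneg_of_derive_nonneg _ (fun t => arcsin_sq_lead N * sin t ^ (2 * N)) t); auto.
    + intros; apply is_derive_arcsin_sq_rem'.
    + intros v Hv; apply Hc, Hv.
  - apply (le_of_derive_le (arcsin_sq_rem' N) (fun u => c * u)
       (fun t => arcsin_sq_lead N * sin t ^ (2 * N)) (fun _ => c) t); auto.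
    + rewrite H01; ring.
    + intros; apply is_derive_arcsin_sq_rem'.
    + intros; auto_derive; [trivial|ring].
    + intros v Hv; apply Hc, Hv. }
split.
- apply (nonneg_of_derive_nonneg _ (arcsin_sq_rem' N) t); auto; try lra.
  + intros; apply is_derive_arcsin_sq_rem.
  + intros v Hv; apply Hd1, Hv.
- apply (le_of_derive_le (arcsin_sq_rem N) (fun u => c * u ^ 2)
       (arcsin_sq_rem' N) (fun u => 2 * (c * u)) t); try lra.
  + intros; apply is_derive_arcsin_sq_rem.
  + intros; auto_derive; [trivial|ring].
  + intros v Hv; pose proof (Hd1 v Hv); lra.
Qed.

Lemma arcsin_sq_partial_sum N t :
  sum_n (fun k => arcsin_sq_coef k * (sin t ^ 2) ^ S k) N
  = 2 * t ^ 2 - arcsin_sq_rem (S N) t :> R.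
Proof.
assert (E : forall k, (sin t ^ 2) ^ S k = sin t ^ (2 * k + 2)).
{ intros k; rewrite <- pow_mult; f_equal; lia. }
induction N as [|N IH].
- rewrite sum_n_0R, E; cbn [arcsin_sq_rem]; simpl (2 * 0 + 2)%nat; ring.
- rewrite sum_n_SR, IH, E; change (arcsin_sq_rem (S (S N)) t) with
    (arcsin_sq_rem (S N) t - arcsin_sq_coef (S N) * sin t ^ (2 * S N + 2)).
  ring.
Qed.

Lemma arcsin_sq_lead_le N : arcsin_sq_lead N <= 4 * (INR N + 1).
Proof.
induction N as [|N IH].
- unfold arcsin_sq_lead, arcsin_sq_coef; simpl; lra.
- rewrite arcsin_sq_lead_S, S_INR; unfold arcsin_sq_lead in IH.
  pose proof (pos_INR N); pose proof (arcsin_sq_coef_pos N).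
  apply Rmult_le_reg_r with (2 * INR N + 1); [lra|].
  apply Rle_trans with ((2 * INR N + 2) * (4 * (INR N + 1))); [nra|nra].
Qed.

Theorem is_series_arcsin_sq t : 0 <= t < PI / 2 ->
  is_series (fun k => arcsin_sq_coef k * (sin t ^ 2) ^ S k) (2 * t ^ 2).
Proof.
intros Ht; apply is_series_lim_seq.
assert (Hs : 0 <= sin t ^ 2 < 1).
{ assert (H1 : 0 <= sin t) by (apply sin_ge_0; lra).
  assert (H2 : sin t < 1) by (rewrite <- sin_PI2; apply sin_increasing_1; lra).
  split; [apply pow2_ge_0|nra]. }
set (s := sin t ^ 2) in *.
assert (Hr : is_lim_seq (fun N => arcsin_sq_rem (S N) t) 0).
{ apply (is_lim_seq_incr_1 (fun N => arcsin_sq_rem N t)).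
  apply is_lim_seq_0_of_le with (v := fun N => (4 * t ^ 2) * ((INR N + 1) * s ^ N)).
  - intros N; destruct (arcsin_sq_rem_bounds N t ltac:(lra)) as [H1 H2].
    rewrite Rabs_pos_eq by exact H1.
    eapply Rle_trans; [exact H2|]; fold s.
    pose proof (arcsin_sq_lead_le N). pose proof (pow_le s N (proj1 Hs)).
    pose proof (pow2_ge_0 t).
    replace (4 * t ^ 2 * ((INR N + 1) * s ^ N)) with (4 * (INR N + 1) * s ^ N * t ^ 2) by ring.
    apply Rmult_le_compat_r; [assumption|]. now apply Rmult_le_compat_r.
  - replace (Finite 0) with (Rbar_mult (4 * t ^ 2) 0) by (simpl; now rewrite Rmult_0_r).
    apply is_lim_seq_scal_l, summable_decreasing_o.
    + intros k; now apply pow_le.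
    + intros k; simpl; pose proof (pow_le s k (proj1 Hs)); nra.
    + apply ex_series_geom; rewrite Rabs_pos_eq; lra. }
apply (is_lim_seq_ext (fun N => 2 * t ^ 2 - arcsin_sq_rem (S N) t)).
- intros N; now rewrite <- arcsin_sq_partial_sum.
- replace (Finite (2 * t ^ 2)) with (Finite (2 * t ^ 2 - 0)) by (f_equal; ring).
  apply is_lim_seq_minus'; [apply is_lim_seq_const | exact Hr].
Qed.

(** At PI/2 the bound on the remainder is useless, since the leading factor grows
    like the square root of N. Instead the partial sums are at most PI^2/2 because
    remainders are nonnegative up to PI/2 included, and their limit is at least 2
    t^2 for every t < PI/2 by termwise comparison. *)
Theorem is_series_arcsin_sq_1 : is_series arcsin_sq_coef (PI ^ 2 / 2).
Proof.
pose proof PI_RGT_0 as HPI.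
assert (Hle : forall N, sum_n arcsin_sq_coef N <= PI ^ 2 / 2).
{ intros N.
  pose proof (arcsin_sq_partial_sum N (PI / 2)) as E; rewrite sin_PI2 in E.
  rewrite (sum_n_ext _ arcsin_sq_coef) in E
    by (intros k; rewrite !pow1; exact (Rmult_1_r _)).
  rewrite E; destruct (arcsin_sq_rem_bounds (S N) (PI / 2) ltac:(lra)). nra. }
assert (Hinc : forall n, sum_n arcsin_sq_coef n <= sum_n arcsin_sq_coef (S n)).
{ intros n; rewrite sum_n_SR; pose proof (arcsin_sq_coef_pos (S n)); lra. }
destruct (ex_finite_lim_seq_incr _ _ Hinc Hle) as [l Hl].
enough (E : l = PI ^ 2 / 2) by (rewrite <- E; exact Hl).
apply Rle_antisym.
- apply (is_lim_seq_le _ (fun _ => PI ^ 2 / 2) l (PI ^ 2 / 2) Hle Hl), is_lim_seq_const.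
- assert (H : forall t, 0 <= t < PI / 2 -> 2 * t ^ 2 <= l).
  { intros t Ht.
    apply (is_lim_seq_le _ (sum_n arcsin_sq_coef) (2 * t ^ 2) l) with
      (2 := is_series_arcsin_sq t Ht); [|exact Hl].
    intros n; apply sum_n_m_le; intros k.
    rewrite <- (Rmult_1_r (arcsin_sq_coef k)) at 2.
    apply Rmult_le_compat_l; [apply Rlt_le, arcsin_sq_coef_pos|].
    rewrite <- (pow1 (S k)). apply pow_incr; split; [apply pow2_ge_0|].
    pose proof (sin2_cos2 t) as E; unfold Rsqr in E; pose proof (pow2_ge_0 (cos t)); simpl in *; lra. }
  destruct (Rle_or_lt (PI ^ 2 / 2) l) as [|Hlt]; [assumption|exfalso].
  assert (Hl0 : 0 <= l) by (pose proof (H 0 ltac:(lra)); lra).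
  (* chosen so that 2 t^2 is halfway between l and PI^2/2 *)
  set (t := sqrt ((l + PI ^ 2 / 2) / 4)).
  assert (Et : t ^ 2 = (l + PI ^ 2 / 2) / 4) by (apply pow2_sqrt; nra).
  assert (Ht0 : 0 <= t) by apply sqrt_pos.
  assert (t < PI / 2) by nra.
  pose proof (H t ltac:(lra)). lra.
Qed.

Lemma sin_sq_PI3 : sin (PI / 3) ^ 2 = 3 / 4.
Proof.
rewrite sin_PI3; unfold Rdiv; rewrite Rpow_mult_distr, pow2_sqrt by lra. field.
Qed.

(** * Kronecker symbols of -4 and -3 *)

Module QuadraticResidues.
From mathcomp Require Import all_boot all_order all_algebra.
From mathcomp Require Import ring.
Import GRing.Theory.
Local Open Scope ring_scope.

Lemma natr_Fp_eq0 (p m : nat) : prime p -> ((m%:R : 'F_p) == 0) = (p %| m)%N.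
Proof.
move=> pp; have ch := pchar_Fp pp.
by rewrite (dvdn_pcharf ch).
Qed.

(** A polynomial of degree d has at most d roots, fewer than the p-1 nonzero
    elements. Powers of such a u provide the roots of unity of order 4 and 3 below. *)
Lemma Fp_exists_pow_neq1 (p d : nat) : prime p -> (0 < d < p.-1)%N ->
  exists2 u : 'F_p, u != 0 & u ^+ d != 1.
Proof.
move=> pp /andP[d0 dp].
apply/exists_inP; apply: contraLR dp; rewrite negb_exists => /forallP H.
rewrite -leqNgt.
have := @max_unity_roots 'F_p d (enum [pred u : 'F_p | u != 0]) d0.
rewrite -cardE enum_uniq.
have -> : #|[pred u : 'F_p | u != 0]| = p.-1.
  have := cardC1 (0 : 'F_p); rewrite card_Fp // => E; rewrite -E.
apply => //.
apply/allP => u; rewrite mem_enum inE => u0.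
have := H u; rewrite negb_and !negbK (negbTE u0) /=.
by rewrite unity_rootE.
Qed.

Lemma Fp_natr (p : nat) (u : 'F_p) : (nat_of_ord u)%:R = u.
Proof. exact: natr_Zp. Qed.

Lemma Fp_fermat (p : nat) (u : 'F_p) : prime p -> u != 0 -> u ^+ p.-1 = 1.
Proof.
move=> pp u0; apply: (mulfI u0); rewrite -exprS (prednK (prime_gt0 pp)) mulr1.
have H : ((u ^ p)%N%:R : 'F_p) = (nat_of_ord u)%:R.
  by apply/val_inj; rewrite /= !val_Fp_nat //; apply: fermat_little.
by move: H; rewrite natrX Fp_natr.
Qed.

(** Passage from the boolean search over 1..p-1 in the definition of the symbol to
    solvability in the prime field. *)
Lemma sqr_addn_Fp (p c : nat) : prime p -> ~~ (p %| c)%N ->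
  reflect (exists x : 'F_p, x ^+ 2 = - c%:R)
    (has (fun x => p %| x ^ 2 + c)%N (iota 1 p.-1)).
Proof.
move=> pp pc; apply: (iffP hasP) => [[x _ dx]|[x Ex]].
  exists x%:R; apply/eqP; rewrite -natrX -subr_eq0 opprK -natrD natr_Fp_eq0 //.
exists (nat_of_ord x); last first.
  by rewrite -natr_Fp_eq0 // natrD natrX Fp_natr Ex addNr.
rewrite mem_iota add1n (prednK (prime_gt0 pp)).
have -> : (x < p)%N by have := ltn_ord x; rewrite {2}Fp_cast.
rewrite andbT lt0n; apply/negP => /eqP x0.
move: Ex; have -> : x = 0 by apply: val_inj.
rewrite expr0n /= => /esym/eqP; rewrite oppr_eq0 natr_Fp_eq0 //.
by apply/negP.
Qed.

(** Half of a square root of -4 is a square root of -1, that is, an element of order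
    4; by Fermat it exists only if 4 divides p-1, and conversely it is found as a
    power of a u with u^((p-1)/2) <> 1. *)
Lemma sqr_neg4 (p : nat) : prime p -> p != 2 ->
  (exists x : 'F_p, x ^+ 2 = - 4%:R) <-> (p %% 4 = 1)%N.
Proof.
move=> pp p2; have p_odd : odd p by case: (even_prime pp) p2 => [->|].
have n2 : (2%:R : 'F_p) != 0.
  by rewrite natr_Fp_eq0 // dvdn_prime2.
have E4 : (4%:R : 'F_p) = 2%:R ^+ 2 by rewrite -natrX.
split=> [[x Ex]|p4].
  pose y := x / 2%:R.
  have y2 : y ^+ 2 = -1.
    by rewrite expr_div_n Ex E4 mulNr divff // expf_neq0.
  have y0 : y != 0.
    apply/eqP => y0; move/eqP: y2; rewrite y0 expr0n /= eq_sym oppr_eq0.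
    by rewrite oner_eq0.
  have := Fp_fermat _ y pp y0.
  have : (p %% 4 = 1 \/ p %% 4 = 3)%N.
    have := ltn_mod p 4; have : odd (p %% 4) by rewrite odd_mod.
    by case: (p %% 4)%N => [|[|[|[|]]]] //; auto.
  case=> // E.
  have -> : p.-1 = (2 * (2 * (p %/ 4)) + 2)%N.
    by rewrite {1}(divn_eq p 4) E addn3 /= mulnC addn2 mulnA.
  rewrite exprD !exprM y2 sqrrN expr1n expr1n mul1r => /eqP.
  rewrite -subr_eq0 -opprD oppr_eq0 -[1]/(1%:R) -natrD.
  by rewrite (negbTE n2).
have p_gt1 := prime_gt1 pp.
pose m := (p %/ 4)%N.
have Ep : p = (m * 4).+1 by rewrite {1}(divn_eq p 4) p4 addn1.
have Em : p.-1 = (m * 4)%N by rewrite {1}Ep.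
have m0 : (0 < m)%N by rewrite lt0n; apply/eqP => m0; move: p_gt1; rewrite Ep m0.
have [|u u0 u1] := Fp_exists_pow_neq1 p (m * 2) pp.
  by rewrite muln_gt0 m0 Em /= ltn_pmul2l.
pose z := u ^+ m.
have z4 : (z ^+ 2) ^+ 2 = 1.
  by rewrite /z -!exprM -Em Fp_fermat.
have z2 : z ^+ 2 = -1.
  move/eqP: z4; rewrite sqrf_eq1 => /orP [/eqP E|/eqP //].
  by move: u1; rewrite exprM E eqxx.
by exists (2%:R * z); rewrite exprMn z2 -E4 mulrN1.
Qed.

(** The square roots of -3 are the 2z+1 with z a primitive cube root of unity; such
    z exists exactly if 3 divides p-1. *)
Lemma sqr_neg3 (p : nat) : prime p -> p != 2 -> p != 3 ->
  (exists x : 'F_p, x ^+ 2 = - 3%:R) <-> (p %% 3 = 1)%N.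
Proof.
move=> pp p2 p3.
have n2 : (2%:R : 'F_p) != 0 by rewrite natr_Fp_eq0 // dvdn_prime2.
have n3 : (3%:R : 'F_p) != 0 by rewrite natr_Fp_eq0 // dvdn_prime2.
have n4 : (4%:R : 'F_p) != 0 by rewrite (natrM _ 2 2) mulf_neq0.
split=> [[x Ex]|E1].
  pose z := (x - 1) / 2%:R.
  have zq : z ^+ 2 + z + 1 = 0.
    apply: (mulfI n4); rewrite mulr0 /z.
    have -> : 4%:R * (((x - 1) / 2%:R) ^+ 2 + (x - 1) / 2%:R + 1) = x ^+ 2 + 3%:R :> 'F_p.
      have E : x - 1 = 2%:R * z by rewrite mulrC divfK.
      rewrite -/z. have -> : x = 2%:R * z + 1 by rewrite -E subrK.
      ring.
    by rewrite Ex addNr.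
  have z3 : z ^+ 3 = 1.
    apply/eqP; rewrite -subr_eq0.
    have -> : z ^+ 3 - 1 = (z - 1) * (z ^+ 2 + z + 1) by ring.
    by rewrite zq mulr0.
  have z1 : z != 1.
    apply/eqP => E; move: zq; rewrite E expr1n -[1]/(1%:R) -!natrD => /eqP.
    by rewrite (negbTE n3).
  have z0 : z != 0.
    apply/eqP => E; move/eqP: z3; rewrite E expr0n /= eq_sym oner_eq0 //.
  have := Fp_fermat _ z pp z0.
  have : (p %% 3 = 1 \/ p %% 3 = 2)%N.
    have := ltn_mod p 3; have : (p %% 3 != 0)%N by rewrite -/(dvdn 3 p) dvdn_prime2 // eq_sym.
    by case: (p %% 3)%N => [|[|[|]]] //; auto.
  case=> // E.
  have -> : p.-1 = (3 * (p %/ 3) + 1)%N.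
    by rewrite {1}(divn_eq p 3) E addn2 /= mulnC addn1.
  by rewrite exprD exprM z3 expr1n mul1r expr1 => /eqP; rewrite (negbTE z1).
have p_gt1 := prime_gt1 pp.
pose m := (p %/ 3)%N.
have Ep : p = (m * 3).+1 by rewrite {1}(divn_eq p 3) E1 addn1.
have Em : p.-1 = (m * 3)%N by rewrite {1}Ep.
have m0 : (0 < m)%N by rewrite lt0n; apply/eqP => m0; move: p_gt1; rewrite Ep m0.
have [|u u0 u1] := Fp_exists_pow_neq1 p m pp.
  by rewrite m0 Em /= -{1}(muln1 m) ltn_pmul2l.
pose z := u ^+ m.
have z3 : z ^+ 3 = 1.
  by rewrite /z -!exprM -Em Fp_fermat.
have zq : z ^+ 2 + z + 1 = 0.
  have : (z - 1) * (z ^+ 2 + z + 1) = 0.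
    have -> : (z - 1) * (z ^+ 2 + z + 1) = z ^+ 3 - 1 by ring.
    by rewrite z3 subrr.
  move/eqP; rewrite mulf_eq0 subr_eq0 => /orP [E|/eqP //].
  by move: u1; rewrite -/z E.
exists (2%:R * z + 1).
have -> : (2%:R * z + 1) ^+ 2 = 4%:R * (z ^+ 2 + z + 1) - 3%:R by ring.
by rewrite zq mulr0 sub0r.
Qed.

#[local] Delimit Scope Z_scope with zz.

Definition chi4 (n : nat) : Z :=
  match (n %% 4)%N with 1 => 1%zz | 3 => (-1)%zz | _ => 0%zz end.
Definition chi3 (n : nat) : Z :=
  match (n %% 3)%N with 1 => 1%zz | 2 => (-1)%zz | _ => 0%zz end.

Lemma chi4M m n : chi4 (m * n)%N = Z.mul (chi4 m) (chi4 n).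
Proof.
rewrite /chi4 -modnMm; have := ltn_mod m 4; have := ltn_mod n 4.
by case: (m %% 4)%N => [|[|[|[|]]]] //; case: (n %% 4)%N => [|[|[|[|]]]].
Qed.

Lemma chi3M m n : chi3 (m * n)%N = Z.mul (chi3 m) (chi3 n).
Proof.
rewrite /chi3 -modnMm; have := ltn_mod m 3; have := ltn_mod n 3.
by case: (m %% 3)%N => [|[|[|]]] //; case: (n %% 3)%N => [|[|[|]]].
Qed.

(** The symbol is defined from the factorisation of n, so a completely
    multiplicative function agrees with it as soon as it does at primes. *)
Lemma kronecker_completely_mult (a : Z) (f : nat -> Z) :
  f 1%N = 1%zz -> (forall m n, f (m * n)%N = Z.mul (f m) (f n)) ->
  (forall p, prime p -> kronecker_prime a p = f p) ->
  forall n, (0 < n)%N -> kronecker a n = f n.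
Proof.
move=> f1 fM fp n n0.
have fX p e : f (p ^ e)%N = Z.pow (f p) (Z.of_nat e).
  by elim: e => [|e IH]; rewrite ?expn0 // expnS fM IH Nat2Z.inj_succ Z.pow_succ_r //; apply: Nat2Z.is_nonneg.
rewrite /kronecker; case: Nat.eqb_spec => [E|_]; first by move: n0; rewrite E.
rewrite [in RHS](prod_prime_decomp n0) prime_decompE big_map /=.
have : all prime (primes n) by apply/allP => p; rewrite mem_primes => /andP [].
elim: (primes n) => [|p s IH] /=; first by rewrite big_nil f1.
move=> /andP [pp /IH ->]; by rewrite big_cons fM fX fp.
Qed.

Lemma Zmod_of_nat_eqb (m p : nat) : (0 < p)%N ->
  Z.eqb (Z.modulo (Z.of_nat m) (Z.of_nat p)) 0 = (p %| m)%N.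
Proof.
move=> p0.
have pz : Z.of_nat p <> 0%zz by move/ltP: p0 => p0; lia.
apply/idP/idP.
  move/Z.eqb_eq/(Z.mod_divide _ _ pz) => [q Eq].
  apply/dvdnP; exists (Z.to_nat q); rewrite -multE.
  have q0 : (0 <= q)%zz by move/ltP: p0 => p0; nia.
  by apply: Nat2Z.inj; rewrite Nat2Z.inj_mul Z2Nat.id.
move/dvdnP => [k ->]; apply/Z.eqb_eq/(Z.mod_divide _ _ pz).
by exists (Z.of_nat k); rewrite -multE Nat2Z.inj_mul.
Qed.

Lemma kronecker_prime_oppE (c p : nat) : prime p -> p != 2 -> ~~ (p %| c)%N ->
  kronecker_prime (Z.opp (Z.of_nat c)) p =
  if has (fun x => p %| x ^ 2 + c)%N (iota 1 p.-1) then 1%zz else (-1)%zz.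
Proof.
move=> pp p2 pc; have p0 := prime_gt0 pp.
rewrite /kronecker_prime; case: Nat.eqb_spec => [E|_]; first by rewrite E in p2.
case: Z.eqb_spec => [E|_].
  have pz : Z.of_nat p <> 0%zz by move/ltP: (p0) => ?; lia.
  move/(Z.mod_divide _ _ pz)/Z.divide_opp_r/(Z.mod_divide _ _ pz)/Z.eqb_eq: E.
  by rewrite Zmod_of_nat_eqb // (negbTE pc).
have -> : List.seq 1 (Nat.sub p 1) = iota 1 p.-1.
  rewrite (_ : Nat.sub p 1 = p.-1); last by case: (p) => //= ?; rewrite Nat.sub_0_r.
  by elim: p.-1 1%N => //= k IH m; rewrite IH.
congr (if _ then _ else _).
elim: (iota 1 p.-1) => //= x s ->; congr (_ || _).
rewrite -Zmod_of_nat_eqb //; congr (Z.eqb (Z.modulo _ _) _).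
by rewrite -plusE Nat2Z.inj_add -[(x ^ 2)%N]/(x * x)%N -multE Nat2Z.inj_mul; lia.
Qed.

Lemma kronecker_m4 (n : nat) : (0 < n)%N -> kronecker (-4)%zz n = chi4 n.
Proof.
apply: kronecker_completely_mult; [by [] | exact: chi4M |] => p pp.
case: (eqVneq p 2) => [->|p2]; first by [].
have p_odd : odd p by case: (even_prime pp) p2 => [->|].
have pc : ~~ (p %| 4)%N by rewrite (_ : 4 = 2 * 2)%N // Euclid_dvdM // dvdn_prime2 // orbb.
rewrite (kronecker_prime_oppE 4) //.
have H := sqr_neg4 p pp p2; rewrite /chi4.
have : (p %% 4 = 1 \/ p %% 4 = 3)%N.
  have := ltn_mod p 4; have : odd (p %% 4) by rewrite odd_mod.
  by case: (p %% 4)%N => [|[|[|[|]]]] //; auto.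
case=> E.
  rewrite E; case: (sqr_addn_Fp p 4 pp pc) => // [[]]. exact/H.
rewrite E; case: (sqr_addn_Fp p 4 pp pc) => // /H; by rewrite E.
Qed.

Lemma kronecker_m3 (n : nat) : (0 < n)%N -> kronecker (-3)%zz n = chi3 n.
Proof.
apply: kronecker_completely_mult; [by [] | exact: chi3M |] => p pp.
case: (eqVneq p 2) => [->|p2]; first by [].
case: (eqVneq p 3) => [->|p3]; first by [].
have pc : ~~ (p %| 3)%N by rewrite dvdn_prime2.
rewrite (kronecker_prime_oppE 3) //.
have H := sqr_neg3 p pp p2 p3; rewrite /chi3.
have : (p %% 3 = 1 \/ p %% 3 = 2)%N.
  have := ltn_mod p 3; have : (p %% 3 != 0)%N by rewrite -/(dvdn 3 p) dvdn_prime2 // eq_sym.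
  by case: (p %% 3)%N => [|[|[|]]] //; auto.
case=> E.
  rewrite E; case: (sqr_addn_Fp p 3 pp pc) => // [[]]. exact/H.
rewrite E; case: (sqr_addn_Fp p 3 pp pc) => // /H; by rewrite E.
Qed.

Lemma kronecker_m4_mod (k r : nat) : lt 0 r ->
  kronecker (-4)%zz (Nat.add (Nat.mul 4 k) r) = chi4 r.
Proof.
move=> /ltP r0; rewrite plusE multE kronecker_m4 ?addn_gt0 ?r0 ?orbT //.
by rewrite /chi4 mulnC modnMDl.
Qed.

Lemma kronecker_m3_mod (k r : nat) : lt 0 r ->
  kronecker (-3)%zz (Nat.add (Nat.mul 3 k) r) = chi3 r.
Proof.
move=> /ltP r0; rewrite plusE multE kronecker_m3 ?addn_gt0 ?r0 ?orbT //.
by rewrite /chi3 mulnC modnMDl.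
Qed.
End QuadraticResidues.

(** * The four elementary base series *)

Lemma Rpower_m2 (x : R) : 0 < x -> Rpower x (- (2)) = / x ^ 2.
Proof.
intros Hx; rewrite Rpower_Ropp; f_equal.
replace 2 with (INR 2) by (simpl; lra). now rewrite Rpower_pow.
Qed.

Lemma is_series_L (k : Z) :
  (forall n, Rabs (chi k (S n)) <= 1) ->
  is_series (fun n => chi k (S n) * / (INR n + 1) ^ 2) (L k 2).
Proof.
intros Hc.
apply (is_series_extR (fun m => chi k (S m) * Rpower (INR (S m)) (- (2)))).
{ intros n; rewrite Rpower_m2, S_INR by (apply lt_0_INR; lia); reflexivity. }
apply Series_correct.
apply (ex_series_leR _ (fun k => / (INR k + 1) ^ 2)); [|apply ex_series_inv_sq; lra].
intros n; rewrite Rpower_m2, S_INR, Rabs_mult by (apply lt_0_INR; lia).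
assert (H : 0 < / (INR n + 1) ^ 2)
  by (apply Rinv_0_lt_compat, pow_lt; pose proof (pos_INR n); lra).
rewrite (Rabs_pos_eq (/ _)) by lra. specialize (Hc n). nra.
Qed.

Lemma is_series_L_m4 :
  is_series (fun k => (-1) ^ k / (2 * INR k + 1) ^ 2) (L (-4) 2).
Proof.
assert (H4 : forall k, chi (-4) (4 * k + 1) = 1 /\ chi (-4) (4 * k + 2) = 0
   /\ chi (-4) (4 * k + 3) = -1 /\ chi (-4) (4 * k + 4) = 0).
{ intros k; unfold chi.
  rewrite !QuadraticResidues.kronecker_m4_mod by lia; repeat split. }
assert (H2 : forall k, chi (-4) (S (2 * k)) = (-1) ^ k /\ chi (-4) (S (2 * k + 1)) = 0).
{ intros k; destruct (Nat.Even_or_Odd k) as [[j ->]|[j ->]]; destruct (H4 j) as (E1 & E2 & E3 & E4).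
  - replace (S (2 * (2 * j))) with (4 * j + 1)%nat by lia.
    replace (S (2 * (2 * j) + 1)) with (4 * j + 2)%nat by lia.
    rewrite E1, E2, pow_1_even; split; reflexivity.
  - replace (S (2 * (2 * j + 1))) with (4 * j + 3)%nat by lia.
    replace (S (2 * (2 * j + 1) + 1)) with (4 * j + 4)%nat by lia.
    replace (2 * j + 1)%nat with (S (2 * j)) by lia.
    rewrite E3, E4, pow_1_odd; split; reflexivity. }
apply (is_series_extR (fun k =>
  chi (-4) (S (2 * k)) * / (INR (2 * k) + 1) ^ 2
  + chi (-4) (S (2 * k + 1)) * / (INR (2 * k + 1) + 1) ^ 2)).
{ intros k; destruct (H2 k) as [-> ->]; rewrite mult_INR; change (INR 2) with 2.
  unfold Rdiv; ring. }
apply (is_series_group2 (fun n => chi (-4) (S n) * / (INR n + 1) ^ 2)), is_series_L.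
intros n; destruct (Nat.Even_or_Odd n) as [[j ->]|[j ->]]; destruct (H2 j) as [E1 E2].
- rewrite E1, pow_1_abs; lra.
- rewrite E2, Rabs_R0; lra.
Qed.

Lemma is_series_L_m3 :
  is_series (fun k => / (3 * INR k + 1) ^ 2 - / (3 * INR k + 2) ^ 2) (L (-3) 2).
Proof.
assert (H3 : forall k, chi (-3) (S (3 * k)) = 1 /\ chi (-3) (S (3 * k + 1)) = -1
   /\ chi (-3) (S (3 * k + 2)) = 0).
{ intros k; unfold chi.
  replace (S (3 * k)) with (3 * k + 1)%nat by lia.
  replace (S (3 * k + 1)) with (3 * k + 2)%nat by lia.
  replace (S (3 * k + 2)) with (3 * k + 3)%nat by lia.
  rewrite !QuadraticResidues.kronecker_m3_mod by lia; repeat split. }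
apply (is_series_extR (fun k =>
  chi (-3) (S (3 * k)) * / (INR (3 * k) + 1) ^ 2
  + chi (-3) (S (3 * k + 1)) * / (INR (3 * k + 1) + 1) ^ 2
  + chi (-3) (S (3 * k + 2)) * / (INR (3 * k + 2) + 1) ^ 2)).
{ intros k; destruct (H3 k) as (-> & -> & ->); rewrite !plus_INR, !mult_INR.
  pose proof (pos_INR k); simpl INR; field; lra. }
apply (is_series_group3 (fun n => chi (-3) (S n) * / (INR n + 1) ^ 2)), is_series_L.
intros n.
assert (Hn : exists j, (n = 3 * j \/ n = 3 * j + 1 \/ n = 3 * j + 2)%nat).
{ exists (n / 3)%nat. pose proof (Nat.div_mod n 3 ltac:(lia)).
  pose proof (Nat.mod_upper_bound n 3 ltac:(lia)). lia. }
destruct Hn as [j Hj]; destruct (H3 j) as (E1 & E2 & E3).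
destruct Hj as [->|[->| ->]]; rewrite ?E1, ?E2, ?E3; apply Rabs_le; lra.
Qed.

(** The pair F(n,k) = Gamma(k+1/2) n!/((k+1/2) Gamma(n+k+3/2)), up to a constant. It
    leads from the sum of 1/(k+1/2)^2 to the arcsine series at PI/2; as the latter
    is known and the former converges, the former is determined. *)
Lemma is_series_half_sq : is_series (fun k => / (INR k + 1/2) ^ 2) (PI ^ 2 / 2).
Proof.
destruct (ex_series_inv_sq (1/2) ltac:(lra) : exists l : R, is_series _ l) as [s Hs].
enough (E : is_series arcsin_sq_coef s).
{ rewrite (is_series_uniq _ _ _ is_series_arcsin_sq_1 E). exact Hs. }
pose (rn := fun x y : R => 2*(x+1)/(2*x+2*y+3)).
pose (rk := fun x y : R => (2*y+1)^2/((2*y+3)*(2*x+2*y+3))).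
pose (Rt := fun x y : R => (2*y+1)/(2*(x+1))).
pose (b := fun k : nat => / (INR k + 1/2) ^ 2).
assert (Hb : is_series b s) by exact Hs.
revert Hb; check_hterm rn rk Rt b; unfold b.
- intros k; rewrite S_INR; nonneg_vars k k; field_pos.
- apply (ex_series_abs _ s); [|exact Hs].
  intros k; pose proof (pos_INR k); apply Rlt_le, Rinv_0_lt_compat, pow_lt; lra.
- intros n; unfold arcsin_sq_coef; cbn [prodR].
  generalize (prodR (fun j => (INR j + 1) ^ 2 / ((INR j + 3/2) * (INR j + 2))) n); intros p.
  nonneg_vars n n; field_pos.
- unfold arcsin_sq_coef; simpl; field.
Qed.

(** Separating odd and even k gives z = 1/4 PI^2/2 + z/4 for the sum z. *)
Lemma is_series_succ_sq : is_series (fun k => / (INR k + 1) ^ 2) (PI ^ 2 / 6).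
Proof.
destruct (ex_series_inv_sq 1 ltac:(lra) : exists l : R, is_series _ l) as [z Hz].
pose proof (is_series_group2 _ _ Hz) as H2.
assert (E : z = 1/4 * (PI ^ 2 / 2) + 1/4 * z).
{ apply (is_series_uniq _ _ _ H2).
  apply (is_series_extR (fun k => 1/4 * / (INR k + 1/2) ^ 2 + 1/4 * / (INR k + 1) ^ 2)).
  - intros k; rewrite plus_INR, mult_INR; simpl INR; pose proof (pos_INR k); field; lra.
  - apply is_series_plusR; apply is_series_scalR; [apply is_series_half_sq | exact Hz]. }
replace (PI ^ 2 / 6) with z by lra. exact Hz.
Qed.

(** * Eight evaluations by one or two transformations *)

Lemma poch_S (x : R) (n : nat) : poch x (S n) = poch x n * (x + INR n).
Proof. reflexivity. Qed.

Lemma poch_pos (x : R) (n : nat) : 0 < x -> 0 < poch x n.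
Proof.
intros Hx; induction n as [|n IH]; [simpl; lra|].
rewrite poch_S; pose proof (pos_INR n); apply Rmult_lt_0_compat; lra.
Qed.

Lemma pow_mul_S (c : R) (d n : nat) : c ^ (d * S n) = c ^ d * c ^ (d * n).
Proof. now rewrite Nat.mul_succ_r, Nat.add_comm, pow_add. Qed.

Lemma pow_S_add (c : R) (n m : nat) : c ^ (S n + m) = c * c ^ (n + m).
Proof. reflexivity. Qed.

Lemma pow_S_l (c : R) (n : nat) : c ^ S n = c * c ^ n.
Proof. reflexivity. Qed.

Ltac pos_var e H :=
  revert H; generalize e; intros ? H.

(** Once Pochhammer symbols of successive indices are related, the symbols
    themselves may be arbitrary positive numbers, and the recurrence for the series
    is an identity of rational functions. *)
Ltac target_recurrence n :=
  rewrite ?(poch_S _ (S n)), ?(pow_mul_S _ _ (S n)), ?(pow_S_add _ (S n)), ?(pow_S_l _ (S n));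
  pose proof (poch_pos 1 (S n) ltac:(lra)) as H1;
  pose proof (poch_pos (1/2) (S n) ltac:(lra)) as H2;
  pose proof (poch_pos (1/3) (S n) ltac:(lra)) as H3;
  pose proof (poch_pos (2/3) (S n) ltac:(lra)) as H4;
  pose proof (poch_pos (1/4) (S n) ltac:(lra)) as H5;
  pose proof (poch_pos (3/4) (S n) ltac:(lra)) as H6;
  pos_var (poch 1 (S n)) H1; pos_var (poch (1/2) (S n)) H2;
  pos_var (poch (1/3) (S n)) H3; pos_var (poch (2/3) (S n)) H4;
  pos_var (poch (1/4) (S n)) H5; pos_var (poch (3/4) (S n)) H6;
  rewrite !S_INR;
  let x := fresh "x" in let Hx := fresh "Hx" in
  pose proof (pos_INR n) as Hx; set (x := INR n) in *; clearbody x.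

(** The pair F(n,k) = (-1)^k (n+2k+1) n! Gamma(k+1/2)^2 Gamma(n+k+1/2) /
    (Gamma(k+3/2) Gamma(n+k+3/2)^2), up to a constant. The resulting series, the sum
    of k!/((k+1/2) Gamma(k+3/2)) up to a constant, is the first row for
    (3n-1)/2^(3n). *)
Lemma is_series_central_catalan :
  is_series (prodR (fun j => (2 * INR j + 1) * (2 * INR j + 2) / (2 * INR j + 3) ^ 2))
    (2 * L (-4) 2).
Proof.
pose (rn := fun x y : R => (x+2+2*y)*(2*(2*x+2*y+1)*(x+1))/((x+1+2*y)*(2*x+2*y+3)^2)).
pose (rk := fun x y : R => - ((x+3+2*y)*(2*y+1)^2*(2*x+2*y+1)/((x+1+2*y)*(2*x+2*y+3)^2*(2*y+3)))).
pose (Rt := fun x y : R => (2*y+1)/(2*(x+1+2*y))).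
pose (b := fun k : nat => 2 * ((-1) ^ k / (2 * INR k + 1) ^ 2)).
assert (Hb : is_series b (2 * L (-4) 2)) by (apply is_series_scalR, is_series_L_m4).
generalize Hb; check_hterm rn rk Rt b; unfold b.
- intros k; rewrite S_INR, pow_S_l; generalize ((-1) ^ k); intros e.
  nonneg_vars k k; field_pos.
- apply (ex_series_leR _ (fun k => (1/2) * / (INR k + 1/2) ^ 2));
    [|apply ex_series_scalR, ex_series_inv_sq; lra].
  intros k; unfold b; pose proof (pos_INR k); unfold Rdiv.
  rewrite Rabs_Rabsolu, !Rabs_mult, pow_1_abs, !Rabs_pos_eq
    by (try lra; apply Rlt_le, Rinv_0_lt_compat, pow_lt; lra).
  apply Req_le; field; lra.
- intros n; cbn [prodR].
  match goal with |- ?p * _ * _ = _ => generalize p end; intros p.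
  nonneg_vars n n; field_pos.
- simpl; field.
Qed.

(** F(n,k) = (-1)^(n+k) (n+2k+1) (n! Gamma(k+1/2)/Gamma(n+k+3/2))^3, up to a
    constant. *)
Lemma sum_4n1_alternating :
  is_sum_from_1
    (fun n => (-1) ^ (n + 1) * (poch 1 n ^ 3 / poch (1/2) n ^ 3)
              * ((4 * INR n - 1) / INR n ^ 3))
    (16 * L (-4) 2).
Proof.
pose (rn := fun x y : R => - ((x+2+2*y)*(8*(x+1)^3) / ((x+1+2*y)*(2*x+2*y+3)^3))).
pose (rk := fun x y : R => - ((x+3+2*y)*(2*y+1)^3 / ((x+1+2*y)*(2*x+2*y+3)^3))).
pose (Rt := fun x y : R => (4*x+2*y+3)/(2*(1+x+2*y))).
(* row 0 is scaled so that G(0,0) = Rt(0,0) b(0) is the first term of the series *)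
pose (b := fun k : nat => 16 * ((-1) ^ k / (2 * INR k + 1) ^ 2)).
assert (Hb : is_series b (16 * L (-4) 2))
  by (apply is_series_scalR, is_series_L_m4).
unfold is_sum_from_1; generalize Hb; check_hterm rn rk Rt b; unfold b.
- intros k; rewrite S_INR, pow_S_l; generalize ((-1) ^ k); intros e.
  nonneg_vars k k; field_pos.
- apply (ex_series_leR _ (fun k => 4 * / (INR k + 1/2) ^ 2));
    [|apply ex_series_scalR, ex_series_inv_sq; lra].
  intros k; unfold b; pose proof (pos_INR k); unfold Rdiv.
  rewrite Rabs_Rabsolu, !Rabs_mult, pow_1_abs, !Rabs_pos_eq
    by (try lra; apply Rlt_le, Rinv_0_lt_compat, pow_lt; lra).
  apply Req_le; field; lra.
- intros n; target_recurrence n.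
  generalize ((-1) ^ (S n + 1)); intros e.
  field; repeat split; apply Rgt_not_eq; poly_pos.
- simpl; field.
Qed.

(** F(n,k) = 4^(-n) (2n+1) n!^3 Gamma(k+1/2)^2 / (Gamma(n+3/2) Gamma(n+k+3/2)^2), up
    to a constant. *)
Lemma sum_3n1_quarter :
  is_sum_from_1
    (fun n => poch 1 n ^ 3 / poch (1/2) n ^ 3
              * ((3 * INR n - 1) / INR n ^ 3) * (1 / 2 ^ (2 * n)))
    (PI ^ 2 / 2).
Proof.
pose (rn := fun x y : R => 2*(x+1)^3/((2*x+1)*(2*x+2*y+3)^2)).
pose (rk := fun x y : R => (2*y+1)^2/(2*x+2*y+3)^2).
pose (Rt := fun x y : R => (3*x+2*y+2)/(2*(2*x+1))).
pose (b := fun k : nat => / (INR k + 1/2) ^ 2).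
assert (Hb : is_series b (PI ^ 2 / 2))
  by (exact is_series_half_sq).
unfold is_sum_from_1; generalize Hb; check_hterm rn rk Rt b; unfold b.
- intros k; rewrite S_INR; nonneg_vars k k; field_pos.
- apply ex_series_abs with (2 := Hb).
  intros k; unfold b; pose proof (pos_INR k).
  apply Rlt_le, Rinv_0_lt_compat, pow_lt; lra.
- intros n; target_recurrence n.
  pose proof (pow_lt 2 (2 * S n) ltac:(lra)) as H7; pos_var (2 ^ (2 * S n)) H7.
  field; repeat split; apply Rgt_not_eq; poly_pos.
- simpl; field.
Qed.

(** F(n,k) = (n+k)!^2 n!^4 / ((2n+k+1)!^2 (2n)!). *)
Lemma sum_21n8 :
  is_sum_from_1
    (fun n => poch 1 n ^ 3 / poch (1/2) n ^ 3
              * ((21 * INR n - 8) / INR n ^ 3) * (1 / 2 ^ (6 * n)))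
    (PI ^ 2 / 6).
Proof.
pose (rn := fun x y : R => (x+1+y)^2*(x+1)^4/((2*x+2+y)^2*(2*x+3+y)^2*(2*x+1)*(2*x+2))).
pose (rk := fun x y : R => (x+1+y)^2/(2*x+2+y)^2).
pose (Rt := fun x y : R => (117 + 258*y + 232*y^2 + 104*y^3 + 23*y^4 + 2*y^5 + 696*x + 1264*x*y
    + 896*x*y^2 + 298*x*y^3 + 44*x*y^4 + 2*x*y^5 + 1690*x^2 + 2432*x^2*y + 1279*x^2*y^2 +
    282*x^2*y^3 + 21*x^2*y^4 + 2148*x^3 + 2300*x^3*y + 800*x^3*y^2 + 88*x^3*y^3 + 1509*x^4 +
    1070*x^4*y + 185*x^4*y^2 + 556*x^5 + 196*x^5*y + 84*x^6) / ((2*x+2+y)^2 * (2*x+3+y)^2 *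
    (2*x+1) * (2*x+2))).
pose (b := fun k : nat => / (INR k + 1) ^ 2).
assert (Hb : is_series b (PI ^ 2 / 6))
  by (exact is_series_succ_sq).
unfold is_sum_from_1; generalize Hb; check_hterm rn rk Rt b; unfold b.
- intros k; rewrite S_INR; nonneg_vars k k; field_pos.
- apply ex_series_abs with (2 := Hb).
  intros k; unfold b; pose proof (pos_INR k).
  apply Rlt_le, Rinv_0_lt_compat, pow_lt; lra.
- intros n; target_recurrence n.
  pose proof (pow_lt 2 (6 * S n) ltac:(lra)) as H7; pos_var (2 ^ (6 * S n)) H7.
  field; repeat split; apply Rgt_not_eq; poly_pos.
- simpl; field.
Qed.

(** F(n,k) = (-1/8)^n 4^(-k) (2n+1) n!^2 (n+2k)! / (Gamma(n+3/2) Gamma(n+k+3/2)^2),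
    up to a constant. *)
Lemma sum_3n1_alternating :
  is_sum_from_1
    (fun n => (-1) ^ (n + 1) * (poch 1 n ^ 3 / poch (1/2) n ^ 3)
              * ((3 * INR n - 1) / INR n ^ 3) * (1 / 2 ^ (3 * n)))
    (2 * L (-4) 2).
Proof.
pose (rn := fun x y : R => - ((x+1)^2*(x+1+2*y)/((2*x+1)*(2*x+2*y+3)^2))).
pose (rk := fun x y : R => (x+1+2*y)*(x+2+2*y)/(2*x+2*y+3)^2).
pose (Rt := fun x y : R => (3*x+2*y+2)/(2*x+1)).
pose (b := fun k : nat => prodR (fun j => (2 * INR j + 1) * (2 * INR j + 2) / (2 * INR j + 3) ^
    2) k).
assert (Hb : is_series b (2 * L (-4) 2))
  by (exact is_series_central_catalan).
unfold is_sum_from_1; generalize Hb; check_hterm rn rk Rt b; unfold b.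
- intros k; cbn [prodR].
  match goal with |- ?p * _ = _ => generalize p end; intros p.
  nonneg_vars k k; field_pos.
- apply ex_series_abs with (2 := Hb).
  intros k; unfold b; apply prodR_pos; intros j; pose proof (pos_INR j).
  apply Rle_mult_inv_pos; [nra|]; apply pow_lt; lra.
- intros n; target_recurrence n.
  generalize ((-1) ^ (S n + 1)); intros e.
  field; repeat split; apply Rgt_not_eq; poly_pos.
- simpl; field.
Qed.

(** F(n,k) = 2^n 4^k n!^2 (n+k)!^2 / (Gamma(n+1/2) (3n+2k+2)!), up to a constant. *)
Lemma sum_10n3 :
  is_sum_from_1
    (fun n => poch 1 n ^ 3 / (poch (1/2) n * poch (1/3) n * poch (2/3) n)
              * ((10 * INR n - 3) / INR n ^ 3) * (2 / 27) ^ n)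
    (PI ^ 2 / 2).
Proof.
pose (rn := fun x y : R => 4*(x+1)^2*(x+y+1)^2/((2*x+1)*(3*x+2*y+3)*(3*x+2*y+4)*(3*x+2*y+5))).
pose (rk := fun x y : R => 4*(x+y+1)^2/((3*x+2*y+3)*(3*x+2*y+4))).
pose (Rt := fun x y : R => (140 + 326*y + 288*y^2 + 112*y^3 + 16*y^4 + 529*x + 900*x*y +
    512*x*y^2 + 96*x*y^3 + 722*x^2 + 798*x^2*y + 220*x^2*y^2 + 423*x^3 + 228*x^3*y + 90*x^4) /
    ((2*x+1) * (3*x+2*y+3) * (3*x+2*y+4) * (3*x+2*y+5))).
pose (b := fun k : nat => arcsin_sq_coef k).
assert (Hb : is_series b (PI ^ 2 / 2))
  by (exact is_series_arcsin_sq_1).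
unfold is_sum_from_1; generalize Hb; check_hterm rn rk Rt b; unfold b.
- intros k; unfold arcsin_sq_coef; cbn [prodR];
  match goal with |- context [prodR ?f k] => generalize (prodR f k) end; intros p.
  nonneg_vars k k; field_pos.
- apply ex_series_abs with (2 := Hb).
  intros k; unfold b; pose proof (arcsin_sq_coef_pos k).
  lra.
- intros n; target_recurrence n.
  generalize ((2 / 27) ^ S n); intros e.
  field; repeat split; apply Rgt_not_eq; poly_pos.
- unfold arcsin_sq_coef; simpl; field.
Qed.

(** F(n,k) = (n+k)! (2n+k)! (2n)! n! / ((3n+k+1)! Gamma(n+k+3/2) Gamma(n+1/2)^2), up
    to a constant. *)
Lemma sum_11n3 :
  is_sum_from_1
    (fun n => poch 1 n ^ 3 / (poch (1/2) n * poch (1/3) n * poch (2/3) n)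
              * ((11 * INR n - 3) / INR n ^ 3) * (16 / 27) ^ n)
    (8 * PI ^ 2).
Proof.
pose (rn := fun x y : R => 8*(x+y+1) * (2*x+y+1) * (2*x+y+2) * (2*x+1) * (2*x+2) * (x+1) /
    ((3*x+y+2) * (3*x+y+3) * (3*x+y+4) * (2*x+2*y+3) * (2*x+1)^2)).
pose (rk := fun x y : R => 2*(x+y+1)*(2*x+y+1)/((3*x+y+2)*(2*x+2*y+3))).
pose (Rt := fun x y : R => (96 + 220*y + 221*y^2 + 123*y^3 + 36*y^4 + 4*y^5 + 748*x + 1460*x*y +
    1191*x*y^2 + 510*x*y^3 + 108*x*y^4 + 8*x*y^5 + 2343*x^2 + 3733*x^2*y + 2306*x^2*y^2 +
    664*x^2*y^3 + 72*x^2*y^4 + 3769*x^3 + 4586*x^3*y + 1896*x^3*y^2 + 272*x^3*y^3 + 3282*x^4 +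
    2708*x^4*y + 560*x^4*y^2 + 1468*x^5 + 616*x^5*y + 264*x^6) / ((3*x+y+2) * (3*x+y+3) *
    (3*x+y+4) * (2*x+2*y+3) * (2*x+1)^2)).
pose (b := fun k : nat => 16 * arcsin_sq_coef k).
assert (Hb : is_series b (8 * PI ^ 2))
  by (replace (8 * PI ^ 2) with (16 * (PI ^ 2 / 2)) by field;
      apply is_series_scalR, is_series_arcsin_sq_1).
unfold is_sum_from_1; generalize Hb; check_hterm rn rk Rt b; unfold b.
- intros k; unfold arcsin_sq_coef; cbn [prodR];
  match goal with |- context [prodR ?f k] => generalize (prodR f k) end; intros p.
  nonneg_vars k k; field_pos.
- apply ex_series_abs with (2 := Hb).
  intros k; unfold b; pose proof (arcsin_sq_coef_pos k).
  lra.
- intros n; target_recurrence n.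
  generalize ((16 / 27) ^ S n); intros e.
  field; repeat split; apply Rgt_not_eq; poly_pos.
- unfold arcsin_sq_coef; simpl; field.
Qed.

(** F(n,k) = (-1)^n (n+2k+1) n!^4 (Gamma(k+1/3) Gamma(k+2/3) / (Gamma(n+k+5/3)
    Gamma(n+k+4/3)))^2 Gamma(n+4/3) Gamma(n+2/3) / (2n)!, up to a constant. *)
Lemma sum_15n4 :
  is_sum_from_1
    (fun n => (-1) ^ (n + 1)
              * (poch 1 n ^ 3 / (poch (1/2) n * poch (1/3) n * poch (2/3) n))
              * ((15 * INR n - 4) / INR n ^ 3) * (1 / 4 ^ n))
    (27 * L (-3) 2).
Proof.
pose (rn := fun x y : R => - (9*(x+2+2*y) * (3*x+4) * (3*x+2) * (x+1)^4 / ((x+1+2*y) *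
    (3*x+3*y+5)^2 * (3*x+3*y+4)^2 * (2*x+1) * (2*x+2)))).
pose (rk := fun x y : R => (x+3+2*y)*((3*y+1)*(3*y+2))^2/((x+1+2*y)*((3*x+3*y+5)*(3*x+3*y+4))^2)).
pose (Rt := fun x y : R => (22+36*y+18*y^2+63*x+54*x*y+45*x^2)/(18*(x+1+2*y)*(2*x+1))).
pose (b := fun k : nat => 27 * (/ (3 * INR k + 1) ^ 2 - / (3 * INR k + 2) ^ 2)).
assert (Hb : is_series b (27 * L (-3) 2))
  by (apply is_series_scalR, is_series_L_m3).
unfold is_sum_from_1; generalize Hb; check_hterm rn rk Rt b; unfold b.
- intros k; rewrite S_INR; nonneg_vars k k; field_pos.
- apply ex_series_abs with (2 := Hb).
  intros k; unfold b; pose proof (pos_INR k).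
  replace (27 * _) with (81 * (2 * INR k + 1) / ((3 * INR k + 1) * (3 * INR k + 2)) ^ 2)
    by (field; lra).
  apply Rle_mult_inv_pos; [lra|]; apply pow_lt, Rmult_lt_0_compat; lra.
- intros n; target_recurrence n.
  generalize ((-1) ^ (S n + 1)); intros e.
  field; repeat split; apply Rgt_not_eq; poly_pos.
- simpl; field.
Qed.

(** F(n,k) = 81^n 3^k n!^2 (n+k)!^2 (2n+k)! / ((4n+k+1)! (2n+2k+1)!), up to a
    constant. The factor 3^k is what calls for the arcsine series at PI/3. *)
Lemma sum_35n8 :
  is_sum_from_1
    (fun n => poch 1 n ^ 3 / (poch (1/2) n * poch (1/4) n * poch (3/4) n)
              * ((35 * INR n - 8) / INR n ^ 3) * (3 / 4) ^ (4 * n))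
    (12 * PI ^ 2).
Proof.
pose (rn := fun x y : R => 81*(x+1)^2 * (x+y+1)^2 * (2*x+y+1) * (2*x+y+2) / ((4*x+y+2) *
    (4*x+y+3) * (4*x+y+4) * (4*x+y+5) * (2*x+2*y+2) * (2*x+2*y+3))).
pose (rk := fun x y : R => 3*(x+y+1)^2*(2*x+y+1)/((4*x+y+2)*(2*x+2*y+2)*(2*x+2*y+3))).
pose (Rt := fun x y : R => (27 + 35*y + 18*y^2 + 4*y^3 + 116*x + 96*x*y + 24*x*y^2 + 159*x^2 +
    63*x^2*y + 70*x^3) / ((4*x+y+2) * (4*x+y+3) * (4*x+y+4))).
pose (b := fun k : nat => 54 * (arcsin_sq_coef k * (sin (PI / 3) ^ 2) ^ S k)).
assert (Hb : is_series b (12 * PI ^ 2))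
  by (replace (12 * PI ^ 2) with (54 * (2 * (PI / 3) ^ 2)) by field;
      apply is_series_scalR, is_series_arcsin_sq; pose proof PI_RGT_0; lra).
unfold is_sum_from_1; generalize Hb; check_hterm rn rk Rt b; unfold b.
- intros k; unfold arcsin_sq_coef; cbn [prodR];
  rewrite sin_sq_PI3, (pow_S_l _ (S k)); generalize ((3/4) ^ S k); intros e;
  match goal with |- context [prodR ?f k] => generalize (prodR f k) end; intros p.
  nonneg_vars k k; field_pos.
- apply ex_series_abs with (2 := Hb).
  intros k; unfold b; pose proof (arcsin_sq_coef_pos k).
  rewrite sin_sq_PI3; pose proof (pow_lt (3/4) (S k) ltac:(lra)).
  apply Rmult_le_pos; [lra|]; apply Rlt_le, Rmult_lt_0_compat; assumption.
- intros n; target_recurrence n.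
  generalize ((3 / 4) ^ (4 * S n)); intros e.
  field; repeat split; apply Rgt_not_eq; poly_pos.
- unfold arcsin_sq_coef; rewrite sin_sq_PI3; simpl; field.
Qed.

(** * A logarithm with two expansions *)

(** Termwise integration of g/(1-r) = sum of g r^k from 0 to a, phrased with
    primitives: the remainder after N terms has derivative g r^(N+1)/(1-r), and H N
    is a primitive of a bound for it. A bound that depends on t is essential when r
    reaches -1 at the end of the interval. *)
Lemma is_series_integral_geom (g r F : R -> R) (f : nat -> R -> R)
    (H : nat -> R -> R) (H' : nat -> R -> R) (a : R) :
  0 <= a ->
  (forall t, 0 <= t <= a -> r t <> 1) ->
  (forall t, 0 <= t <= a -> is_derive F t (g t / (1 - r t))) -> F 0 = 0 ->
  (forall k t, 0 <= t <= a -> is_derive (f k) t (g t * r t ^ k)) ->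
  (forall k, f k 0 = 0) ->
  (forall k t, 0 <= t <= a -> is_derive (H k) t (H' k t)) -> (forall k, H k 0 = 0) ->
  (forall k t, 0 <= t <= a -> Rabs (g t / (1 - r t) * r t ^ S k) <= H' k t) ->
  is_lim_seq (fun k => H k a) 0 ->
  is_series (fun k => f k a) (F a).
Proof.
intros Ha Hr HF HF0 Hf Hf0 HH HH0 Hb Hlim.
assert (Hd : forall N t, 0 <= t <= a ->
  is_derive (fun t => F t - sum_n (fun k => f k t) N) t (g t / (1 - r t) * r t ^ S N)).
{ intros N t Ht; specialize (Hr t Ht); induction N as [|N IH].
  - apply (is_derive_extR (fun t => F t - f O t)); [intros u; now rewrite sum_n_0R|].
    replace (g t / (1 - r t) * r t ^ 1) with (g t / (1 - r t) - g t * r t ^ 0)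
      by (field; lra).
    apply (is_derive_minus F (f O)); auto.
  - apply (is_derive_extR (fun t => (F t - sum_n (fun k => f k t) N) - f (S N) t)).
    { intros u; rewrite sum_n_SR; ring. }
    replace (g t / (1 - r t) * r t ^ S (S N))
      with (g t / (1 - r t) * r t ^ S N - g t * r t ^ S N) by (simpl; field; lra).
    apply (is_derive_minus (fun t => F t - sum_n (fun k => f k t) N) (f (S N))); auto. }
assert (H0 : forall N, F 0 - sum_n (fun k => f k 0) N = 0).
{ intros N; rewrite HF0; induction N as [|N IH].
  - rewrite sum_n_0R, Hf0; ring.
  - rewrite sum_n_SR, Hf0; lra. }
assert (Hrem : forall N, Rabs (F a - sum_n (fun k => f k a) N) <= H N a).
{ intros N; apply Rabs_le; split.
  - apply (le_of_derive_le (fun t => - H N t) (fun t => F t - sum_n (fun k => f k t) N)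
      (fun t => - H' N t) (fun t => g t / (1 - r t) * r t ^ S N) a); [|..|lra]; auto.
    + rewrite H0, HH0; ring.
    + intros t Ht; apply (is_derive_opp (H N)); auto.
    + intros t Ht; specialize (Hb N t Ht); apply Rabs_le_between in Hb; lra.
  - apply (le_of_derive_le (fun t => F t - sum_n (fun k => f k t) N) (H N)
      (fun t => g t / (1 - r t) * r t ^ S N) (H' N) a); [|..|lra]; auto.
    + now rewrite H0, HH0.
    + intros t Ht; specialize (Hb N t Ht); apply Rabs_le_between in Hb; lra. }
apply is_series_lim_seq.
apply (is_lim_seq_ext (fun N => F a - (F a - sum_n (fun k => f k a) N))); [intros; ring|].
replace (Finite (F a)) with (Finite (F a - 0)) by (f_equal; ring).
apply is_lim_seq_minus'; [apply is_lim_seq_const|].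
apply is_lim_seq_0_of_le with (2 := Hlim); exact Hrem.
Qed.

Lemma is_derive_pow_div (m : nat) (t : R) :
  is_derive (fun t => t ^ S m / INR (S m)) t (t ^ m).
Proof.
pose proof (lt_0_INR (S m) ltac:(lia)) as Hm.
replace (t ^ m) with (/ INR (S m) * (INR (S m) * 1 * t ^ m)) by (field; lra).
apply (is_derive_extR (fun t => / INR (S m) * t ^ S m)); [intros; unfold Rdiv; ring|].
apply (is_derive_scal (fun t => t ^ S m)).
apply (is_derive_pow (fun t => t) (S m) t 1); apply (is_derive_id t).
Qed.

Lemma is_series_artanh (a : R) : 0 <= a < 1 ->
  is_series (fun k => a ^ (2 * k + 1) / INR (2 * k + 1)) ((ln (1 + a) - ln (1 - a)) / 2).
Proof.
intros Ha.
apply (is_series_integral_geom (fun _ => 1) (fun t => t ^ 2)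
  (fun t => (ln (1 + t) - ln (1 - t)) / 2)
  (fun k t => t ^ (2 * k + 1) / INR (2 * k + 1))
  (fun k t => (a ^ 2) ^ S k / (1 - a ^ 2) * t) (fun k t => (a ^ 2) ^ S k / (1 - a ^ 2)) a); try lra.
- intros t Ht; nra.
- intros t Ht; auto_derive; [lra|]; field; nra.
- rewrite Rplus_0_r, Rminus_0_r; field.
- intros k t Ht; rewrite Nat.add_1_r, <- pow_mult, Rmult_1_l; apply is_derive_pow_div.
- intros k; rewrite pow_i by lia; unfold Rdiv; ring.
- intros k t Ht; generalize ((a ^ 2) ^ S k / (1 - a ^ 2)); intros c; auto_derive; [trivial|ring].
- intros k; ring.
- intros k t Ht; assert (0 <= t ^ 2 <= a ^ 2) by (split; [apply pow2_ge_0 | nra]).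
  assert (a ^ 2 < 1) by nra.
  rewrite Rabs_pos_eq.
  + unfold Rdiv; rewrite Rmult_1_l, Rmult_comm; apply Rmult_le_compat.
    * apply pow_le; lra.
    * apply Rlt_le, Rinv_0_lt_compat; lra.
    * apply pow_incr; lra.
    * apply Rinv_le_contravar; lra.
  + apply Rmult_le_pos; [|apply pow_le; lra].
    apply Rle_mult_inv_pos; lra.
- apply (is_lim_seq_ext (fun k => a / (1 - a ^ 2) * (a ^ 2) ^ S k)).
  { intros k; field; nra. }
  replace (Finite 0) with (Rbar_mult (a / (1 - a ^ 2)) 0) by (simpl; now rewrite Rmult_0_r).
  apply is_lim_seq_scal_l, (is_lim_seq_incr_1 (fun k => (a ^ 2) ^ k)).
  apply is_lim_seq_geom; rewrite Rabs_pos_eq; [nra | apply pow2_ge_0].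
Qed.

(** The value at 1 of the Dirichlet series of the primitive even character modulo
    12. *)
Definition L12_1 : R := ln (2 + sqrt 3) / sqrt 3.

Lemma sqrt3_sq : sqrt 3 * sqrt 3 = 3.
Proof. apply sqrt_sqrt; lra. Qed.

Lemma sqrt3_bounds : 17 / 10 < sqrt 3 < 18 / 10.
Proof.
pose proof sqrt3_sq; pose proof (sqrt_lt_R0 3 ltac:(lra)); split; nra.
Qed.

(** Integral from 0 to 1 of (1-t^4)/(1+t^6) = (1-t^2)/(1-t^2+t^4), expanded in
    powers of -t^6. The quartic factors over the field of sqrt 3 as (1 + sqrt 3 t +
    t^2)(1 - sqrt 3 t + t^2). *)
Lemma is_series_L12_1 :
  is_series (fun k => (-1) ^ k * (/ (6 * INR k + 1) - / (6 * INR k + 5))) L12_1.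
Proof.
pose proof sqrt3_sq as E3; pose proof sqrt3_bounds as B3.
unfold L12_1; set (s := sqrt 3) in *.
assert (Hpos : forall t, 0 < 1 + s * t + t ^ 2 /\ 0 < 1 - s * t + t ^ 2).
{ intros t; split.
  - replace (1 + s * t + t ^ 2) with ((t + s / 2) ^ 2 + (1 - s * s / 4)) by field.
    rewrite E3; pose proof (pow2_ge_0 (t + s / 2)); lra.
  - replace (1 - s * t + t ^ 2) with ((t - s / 2) ^ 2 + (1 - s * s / 4)) by field.
    rewrite E3; pose proof (pow2_ge_0 (t - s / 2)); lra. }
pose (F := fun t => (ln (1 + s * t + t ^ 2) - ln (1 - s * t + t ^ 2)) / (2 * s)).
pose (f := fun k t => (-1) ^ k * (t ^ (6 * k + 1) / INR (6 * k + 1) - t ^ (6 * k + 5) / INR (6 *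
    k + 5))).
assert (EF : F 1 = ln (2 + s) / s).
{ unfold F.
  replace (1 + s * 1 + 1 ^ 2) with (2 + s) by ring.
  replace (1 - s * 1 + 1 ^ 2) with (/ (2 + s)) by (apply Rmult_eq_reg_l with (2 + s); [|lra]; rewrite Rinv_r by lra; nra).
  rewrite ln_Rinv by lra; field; lra. }
rewrite <- EF.
apply (is_series_extR (fun k => f k 1)).
{ intros k; unfold f; rewrite !pow1, !plus_INR, !mult_INR; simpl INR.
  pose proof (pos_INR k); field; lra. }
apply (is_series_integral_geom (fun t => 1 - t ^ 4) (fun t => - t ^ 6) F f
  (fun k t => t ^ (6 * k + 7) / INR (6 * k + 7)) (fun k t => t ^ (6 * k + 6)) 1); try lra.
- intros t Ht; pose proof (pow_le t 6 ltac:(lra)); lra.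
- intros t Ht; destruct (Hpos t) as [H1 H2]; pose proof (pow_le t 6 ltac:(lra)).
  unfold F; auto_derive; [repeat split; lra|].
  assert (E : (1 + s * t + t ^ 2) * (1 - s * t + t ^ 2) = 1 - t ^ 2 + t ^ 4)
    by (transitivity ((1 + t ^ 2) ^ 2 - (s * s) * t ^ 2); [ring | rewrite E3; ring]).
  assert (H3 : 0 < 1 - t ^ 2 + t ^ 4) by (rewrite <- E; apply Rmult_lt_0_compat; lra).
  transitivity ((1 - t ^ 2) / ((1 + s * t + t ^ 2) * (1 - s * t + t ^ 2))).
  + field; repeat split; lra.
  + rewrite E; field; split; lra.
- unfold F; rewrite Rmult_0_r, !pow_i by lia; unfold Rminus; rewrite Ropp_0, !Rplus_0_r.
  unfold Rdiv; ring.
- intros k t Ht; unfold f.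
  replace ((1 - t ^ 4) * (- t ^ 6) ^ k) with ((-1) ^ k * (t ^ (6 * k) - t ^ (6 * k + 4))).
  2:{ rewrite pow_add, pow_mult. replace (- t ^ 6) with (-1 * t ^ 6) by ring.
      rewrite Rpow_mult_distr; ring. }
  apply (is_derive_scal (fun t => t ^ (6 * k + 1) / INR (6 * k + 1) - t ^ (6 * k + 5) / INR (6 * k + 5))).
  replace (6 * k + 1)%nat with (S (6 * k)) by lia.
  replace (6 * k + 5)%nat with (S (6 * k + 4)) by lia.
  apply (is_derive_minus (fun t => t ^ S (6 * k) / INR (S (6 * k)))
     (fun t => t ^ S (6 * k + 4) / INR (S (6 * k + 4)))); apply is_derive_pow_div.
- intros k; unfold f; rewrite !pow_i by lia; unfold Rdiv; ring.
- intros k t Ht; replace (6 * k + 7)%nat with (S (6 * k + 6)) by lia; apply is_derive_pow_div.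
- intros k; rewrite pow_i by lia; unfold Rdiv; ring.
- intros k t Ht.
  assert (H4 : 0 <= t ^ 4 <= 1) by (split; [apply pow_le; lra | rewrite <- (pow1 4); apply pow_incr; lra]).
  pose proof (pow_le t 6 ltac:(lra)) as H6.
  rewrite Rabs_mult, <- RPow_abs, Rabs_Ropp, (Rabs_pos_eq (t ^ 6)) by exact H6.
  replace (6 * k + 6)%nat with (6 * S k)%nat by lia; rewrite pow_mult.
  rewrite <- (Rmult_1_l ((t ^ 6) ^ S k)) at 2.
  apply Rmult_le_compat_r; [now apply pow_le|].
  rewrite Rabs_pos_eq by (apply Rle_mult_inv_pos; lra).
  apply Rle_div_l; lra.
- apply is_lim_seq_0_of_le with (v := fun k => / (INR k + 7)); [|apply is_lim_seq_inv_shift; lra].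
  intros k; rewrite pow1; unfold Rdiv; rewrite Rmult_1_l, plus_INR, mult_INR; simpl INR.
  pose proof (pos_INR k).
  rewrite Rabs_pos_eq by (apply Rlt_le, Rinv_0_lt_compat; lra).
  apply Rinv_le_contravar; lra.
Qed.

(** Equal to (-1/2)^n n!/(3/2)_n. *)
Definition log_alternating_term (n : nat) : R := prodR (fun j => - ((INR j + 1) / (2 * INR j + 3))) n.

(** The pair F(n,k) = (-1/2)^n 3^(-k) B(n+1,k+1/2), with G = 3/2 F: under the Beta
    integral both differences multiply the integrand by the same factor 1 + t/2, up
    to a constant. The first row is the expansion of artanh(1/sqrt 3) = log(2+sqrt
    3)/2. *)
Lemma is_series_log_alternating_term : is_series log_alternating_term L12_1.
Proof.
pose proof sqrt3_sq as E3; pose proof sqrt3_bounds as B3.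
pose (rn := fun x y : R => - ((x+1)/(2*x+2*y+3))).
pose (rk := fun x y : R => (2*y+1)/(3*(2*x+2*y+3))).
pose (Rt := fun x y : R => 3/2).
pose (b := fun k : nat => 2 / 3 * ((1 / 3) ^ k / (2 * INR k + 1))).
assert (Hb : is_series b L12_1).
{ unfold L12_1; set (s := sqrt 3) in *.
  assert (Ei : / s * / s = 1 / 3) by (rewrite <- Rinv_mult, E3; field).
  assert (Bi : 0 <= / s < 1).
  { split; [apply Rlt_le, Rinv_0_lt_compat; lra|].
    rewrite <- Rinv_1; apply Rinv_lt_contravar; lra. }
  pose proof (is_series_scalR (2 / 3 * s) _ _ (is_series_artanh (/ s) Bi)) as H.
  replace (ln (2 + s) / s) with (2 / 3 * s * ((ln (1 + / s) - ln (1 - / s)) / 2)).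
  - apply (is_series_extR _ _ _) with (2 := H).
    intros k; unfold b; rewrite pow_add, pow_mult.
    replace ((/ s) ^ 2) with (1 / 3) by (rewrite <- Ei; ring).
    rewrite plus_INR, mult_INR; simpl INR; pose proof (pos_INR k); field; lra.
  - assert (H1 : 1 + / s = (2 + s) * (1 - / s)).
    { apply Rmult_eq_reg_l with s; [|lra].
      replace (s * (1 + / s)) with (s + 1) by (field; lra).
      replace (s * ((2 + s) * (1 - / s))) with (s * s + s - 2) by (field; lra). lra. }
    rewrite H1, ln_mult by lra.
    replace (/ s) with (s / 3) at 3 by (rewrite <- E3; field; lra).
    unfold Rdiv; replace (/ s) with (s / 3) by (rewrite <- E3; field; lra). field. }
apply (hterm_acceleration rn rk Rt b log_alternating_term L12_1); unfold rn, rk, Rt; try exact Hb.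
- rat_identity.
- rat_identity.
- rat_bound.
- intros n k; pose proof (pos_INR k); rewrite Rabs_pos_eq; lra.
- intros k; unfold b; rewrite S_INR, pow_S_l; generalize ((1 / 3) ^ k); intros e.
  nonneg_vars k k; field_pos.
- rat_bound.
- apply ex_series_abs with (2 := Hb); intros k; unfold b; pose proof (pos_INR k).
  pose proof (pow_lt (1 / 3) k ltac:(lra)).
  apply Rmult_le_pos; [lra|]; apply Rle_mult_inv_pos; lra.
- intros; lra.
- intros n; unfold log_alternating_term; cbn [prodR].
  match goal with |- context [prodR ?f n] => generalize (prodR f n) end; intros p.
  nonneg_vars n n; field_pos.
- unfold log_alternating_term, b; simpl; field.
Qed.

(** * The evaluation with nonvanishing boundary *)

(** Equal to l!^2 / ((7/6)_l (11/6)_l (2l+1)). *)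
Definition row12 (l : nat) : R :=
  prodR (fun j => 36 * (INR j + 1) ^ 2 * (2 * INR j + 1)
                  / ((2 * INR j + 3) * (6 * INR j + 7) * (6 * INR j + 11))) l.

Lemma row12_S l : row12 (S l) =
  36 * (INR l + 1) ^ 2 * (2 * INR l + 1)
  / ((2 * INR l + 3) * (6 * INR l + 7) * (6 * INR l + 11)) * row12 l.
Proof. unfold row12; cbn [prodR]; ring. Qed.

Lemma row12_pos l : 0 < row12 l.
Proof.
induction l as [|l IH]; [unfold row12; simpl; lra|].
rewrite row12_S; apply Rmult_lt_0_compat; [|exact IH]; pose proof (pos_INR l).
apply Rdiv_lt_0_compat; poly_pos.
Qed.

Lemma row12_scaled_decr l :
  (INR (S l) + 1) * (INR (S l) + 1/2) * row12 (S l)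
  <= (INR l + 1) * (INR l + 1/2) * row12 l.
Proof.
rewrite row12_S, S_INR; pose proof (row12_pos l) as H; pose proof (pos_INR l) as Hl.
set (x := INR l) in *; clearbody x.
replace ((x + 1 + 1) * (x + 1 + 1/2) * (36 * (x + 1) ^ 2 * (2 * x + 1)
  / ((2 * x + 3) * (6 * x + 7) * (6 * x + 11)) * row12 l))
 with ((x + 1) * (x + 1/2) * row12 l * (36 * (x + 1) * (x + 2) / ((6 * x + 7) * (6 * x + 11))))
 by (field; lra).
rewrite <- (Rmult_1_r ((x + 1) * (x + 1/2) * row12 l)) at 2.
apply Rmult_le_compat_l; [repeat apply Rmult_le_pos; lra|].
apply Rle_div_l; [poly_pos|nra].
Qed.

Lemma row12_limit :
  exists U : R, is_lim_seq (fun l => (INR l + 1) * (INR l + 1/2) * row12 l) U.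
Proof.
apply (ex_finite_lim_seq_decr _ 0).
- exact row12_scaled_decr.
- intros l; pose proof (row12_pos l); pose proof (pos_INR l).
  repeat apply Rmult_le_pos; lra.
Qed.

Lemma row12_le l : row12 l <= / (INR l + 1) * / (INR l + 1).
Proof.
pose proof (pos_INR l) as Hl.
assert (H : (INR l + 1) * (INR l + 1/2) * row12 l <= 1/2).
{ clear Hl; induction l as [|l IH]; [unfold row12; simpl; lra|].
  eapply Rle_trans; [apply row12_scaled_decr | exact IH]. }
pose proof (row12_pos l).
apply Rmult_le_reg_l with ((INR l + 1) * (INR l + 1)); [nra|].
replace ((INR l + 1) * (INR l + 1) * (/ (INR l + 1) * / (INR l + 1))) with 1 by (field; lra).
nra.
Qed.

Lemma ex_series_row12 : ex_series row12.
Proof.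
apply (ex_series_leR _ (fun k => / (INR k + 1) ^ 2)); [|apply ex_series_inv_sq; lra].
intros l; rewrite Rabs_pos_eq by (apply Rlt_le, row12_pos).
eapply Rle_trans; [apply row12_le|]. apply Req_le. pose proof (pos_INR l); field; lra.
Qed.

(** Limits at infinity of a rational function of l are read off as values at z = 0
    after the substitution l = 1/z - 1. *)
Lemma is_lim_seq_at_infty (f : R -> R) (u : nat -> R) :
  ex_derive f 0 -> (forall l, u l = f (/ (INR l + 1))) -> is_lim_seq u (f 0).
Proof.
intros Hf Hu.
apply (is_lim_seq_ext (fun l => f (/ (INR l + 1)))); [intros; now rewrite Hu|].
apply (is_lim_seq_continuous f (fun l => / (INR l + 1)) 0).
- now apply continuity_pt_filterlim, (ex_derive_continuous f).
- apply is_lim_seq_inv_shift; lra.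
Qed.

Lemma is_lim_seq_prodR (f : nat -> nat -> R) (c : nat -> R) (n : nat) :
  (forall i, is_lim_seq (f i) (c i)) ->
  is_lim_seq (fun l => prodR (fun i => f i l) n) (prodR c n).
Proof.
intros H; induction n as [|n IH]; cbn [prodR]; [apply is_lim_seq_const|].
now apply is_lim_seq_mult'.
Qed.

Lemma hterm_from_row0 rn rk n k :
  compatible rn rk ->
  hterm rn rk n k = prodR (fun i => rn (INR i) (INR k)) n * hterm rn rk 0 k.
Proof.
intros Hc; induction n as [|n IH]; cbn [prodR]; [ring|].
rewrite hterm_Sn, IH by exact Hc; ring.
Qed.

(** The boundary of G in the direction of k: w carries the growth of Rt and the
    decay of row 0, while the ratios in n pass to the limit one by one. *)
Lemma is_lim_seq_boundary rn rk Rt (c : nat -> R) (w : nat -> R) (d U : R) n :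
  compatible rn rk ->
  (forall i, is_lim_seq (fun k => rn (INR i) (INR k)) (c i)) ->
  (forall k, w k <> 0) ->
  is_lim_seq (fun k => Rt (INR n) (INR k) / w k) d ->
  is_lim_seq (fun k => w k * hterm rn rk 0 k) U ->
  is_lim_seq (fun k => Rt (INR n) (INR k) * hterm rn rk n k) (d * prodR c n * U).
Proof.
intros Hc Hr Hw Hd HU.
apply (is_lim_seq_ext (fun k => Rt (INR n) (INR k) / w k
  * prodR (fun i => rn (INR i) (INR k)) n * (w k * hterm rn rk 0 k))).
- intros k; rewrite (hterm_from_row0 rn rk n k Hc); field; apply Hw.
- apply is_lim_seq_mult'; [apply is_lim_seq_mult'; [exact Hd|]|exact HU].
  now apply is_lim_seq_prodR with (f := fun i k => rn (INR i) (INR k)).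
Qed.

(** F(n,l) = (-9/4)^n (27/4)^l (n+2) n! (n+l)! (n+2l)! / (Gamma(n+1/2)
    Gamma(2n+3l+7/2)), up to a constant. G grows like l^2 F, so that its boundary
    does not vanish. *)
Lemma sum_5n1_row (U : R) :
  is_lim_seq (fun l => (INR l + 1) * (INR l + 1/2) * row12 l) U ->
  is_series (fun n =>
    5 / 12 * ((-1) ^ (S n + 1) * (poch 1 (S n) ^ 3 / (poch (1/2) (S n) * poch (1/4) (S n) * poch (3/4) (S n)))
      * ((5 * INR (S n) - 1) / INR (S n) ^ 3) * (3 / 4) ^ (2 * S n))
    - 18 * U * log_alternating_term n) (Series row12).
Proof.
intros HU.
pose (rn := fun x y : R => - (18*(x+1+2*y) * (x+1+y) * (x+3) * (x+1) / ((x+2) * (4*x+6*y+7) *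
    (4*x+6*y+9) * (2*x+1)))).
pose (rk := fun x y : R => 54*(x+1+2*y)*(x+2+2*y)*(x+1+y)/((4*x+6*y+7)*(4*x+6*y+9)*(4*x+6*y+11))).
pose (Rt := fun x y : R => (1260 + 5322*y + 8172*y^2 + 5400*y^3 + 1296*y^4 + 3863*x + 11754*x*y
    + 11556*x*y^2 + 3672*x*y^3 + 4204*x^2 + 8208*x^2*y + 3888*x^2*y^2 + 1936*x^3 + 1824*x^3*y +
    320*x^4) / ((x+2) * (2*x+1) * (4*x+6*y+7) * (4*x+6*y+9))).
assert (Hc : compatible rn rk).
{ unfold rn, rk; rat_identity. }
assert (Hw : certified rn rk Rt).
{ unfold rn, rk, Rt; rat_identity. }
assert (H0 : forall k, hterm rn rk 0 k = row12 k).
{ intros k; rewrite <- (hterm_row0 rn rk row12).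
  - unfold row12 at 1; simpl; ring.
  - clear k; intros k; rewrite row12_S; unfold rk; nonneg_vars k k; field_pos. }
(* the bound 9/16 comes from (n+2l+1)(n+l+1) <= (2n+3l+7/2)(2n+3l+9/2)/4; the
   remaining factor exceeds 1 and makes the first two values useless *)
pose (rho := fun n : nat => 9 * (INR n + 3) * (INR n + 1) / (8 * (INR n + 2) * (2 * INR n + 1))).
assert (Hr : forall n k : nat, Rabs (rn (INR n) (INR k)) <= rho n).
{ unfold rn, rho; rat_bound. }
assert (HG : forall n, is_lim_seq (fun k => Rt (INR n) (INR k) * hterm rn rk n k) (18 * U * log_alternating_term n)).
{ intros n.
  assert (E : 18 * U * log_alternating_term n
    = 36 / ((INR n + 2) * (2 * INR n + 1))
      * prodR (fun i => - ((INR i + 3) * (INR i + 1) / ((INR i + 2) * (2 * INR i + 1)))) n * U).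
  { clear; unfold log_alternating_term; induction n as [|n IH]; [simpl; field|].
    cbn [prodR]; rewrite S_INR; pose proof (pos_INR n).
    transitivity (18 * U * prodR (fun j => - ((INR j + 1) / (2 * INR j + 3))) n
      * - ((INR n + 1) / (2 * INR n + 3))); [ring|].
    rewrite IH; field; lra. }
  rewrite E.
  apply is_lim_seq_boundary with (w := fun l => (INR l + 1) * (INR l + 1/2)); [exact Hc| | | |].
  - intros i; pose proof (pos_INR i).
    pose (f := fun z => - (18*((INR i-1)*z+2)*(INR i*z+1)*(INR i+3)*(INR i+1)
       /((INR i+2)*((4*INR i+1)*z+6)*((4*INR i+3)*z+6)*(2*INR i+1)))).
    replace (- ((INR i + 3) * (INR i + 1) / ((INR i + 2) * (2 * INR i + 1)))) with (f 0)
      by (unfold f; field; lra).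
    apply is_lim_seq_at_infty.
    + unfold f; auto_derive; apply Rgt_not_eq; rewrite !Rmult_0_r, !Rplus_0_l; poly_pos.
    + intros l; unfold f, rn; pose proof (pos_INR l); field; lra.
  - intros k; pose proof (pos_INR k); apply Rgt_not_eq; nra.
  - set (x := INR n); assert (Hx : 0 <= x) by apply pos_INR; clearbody x.
    pose (f := fun z => (1260*z^4 + 5322*(1-z)*z^3 + 8172*(1-z)^2*z^2 + 5400*(1-z)^3*z +
        1296*(1-z)^4 + 3863*x*z^4 + 11754*x*(1-z)*z^3 + 11556*x*(1-z)^2*z^2 + 3672*x*(1-z)^3*z +
        4204*x^2*z^4 + 8208*x^2 * (1-z)*z^3 + 3888*x^2 * (1-z)^2*z^2 + 1936*x^3*z^4 +
        1824*x^3*(1-z)*z^3 + 320*x^4*z^4) / ((x+2) * (2*x+1) * ((4*x+1)*z+6) * ((4*x+3)*z+6) *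
        (1-z/2))).
    replace (36 / ((x + 2) * (2 * x + 1))) with (f 0) by (unfold f; field; lra).
    apply is_lim_seq_at_infty.
    + unfold f; auto_derive; apply Rgt_not_eq; rewrite !Rmult_0_r, !Rplus_0_l.
      repeat apply Rmult_lt_0_compat; lra.
    + intros l; unfold f, Rt; pose proof (pos_INR l); field; lra.
  - apply (is_lim_seq_ext _ _ _) with (2 := HU); intros k; now rewrite H0. }
assert (Ht : forall n, 5 / 12 * ((-1) ^ (S n + 1) * (poch 1 (S n) ^ 3 / (poch (1/2) (S n) * poch (1/4) (S n) * poch (3/4) (S n)))
      * ((5 * INR (S n) - 1) / INR (S n) ^ 3) * (3 / 4) ^ (2 * S n))
    = Rt (INR n) (INR 0) * hterm rn rk n 0).
{ induction n as [|n IH].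
  - unfold Rt, hterm; simpl; field.
  - rewrite hterm_Sn, (S_INR n) by exact Hc.
    assert (Hn : Rt (INR n) (INR 0) <> 0).
    { unfold Rt; simpl (INR 0). clear; pose proof (pos_INR n).
      apply Rgt_not_eq, Rdiv_lt_0_compat; [|poly_pos].
      ring_simplify; apply Rplus_le_lt_0_compat; [poly_nonneg | lra]. }
    apply Rmult_eq_reg_l with (Rt (INR n) (INR 0)); [|exact Hn].
    transitivity (Rt (INR n + 1) (INR 0) * rn (INR n) (INR 0) * (Rt (INR n) (INR 0) * hterm rn rk n 0)); [|ring].
    rewrite <- IH; unfold Rt, rn; simpl (INR 0); clear.
    target_recurrence n.
    generalize ((-1) ^ (S n + 1)); intros e1; generalize ((3 / 4) ^ (2 * S n)); intros e2.
    field; repeat split; apply Rgt_not_eq; poly_pos. }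
apply (is_series_extR (fun n => Rt (INR n) (INR 0) * hterm rn rk n 0 - 18 * U * log_alternating_term n)).
{ intros n; now rewrite Ht. }
apply (wz_telescoping (hterm rn rk) (fun n k => Rt (INR n) (INR k) * hterm rn rk n k)).
- intros n k; now apply hterm_wz.
- apply (is_series_extR row12); [intros; now rewrite H0|]. apply Series_correct, ex_series_row12.
- exact HG.
- apply (hterm_Series_to_0 rn rk rho 2); [exact Hc | exact Hr | |].
  + intros n Hn; unfold rho; pose proof (le_INR _ _ Hn) as Hn'; simpl INR in Hn'.
    replace (INR n) with ((INR n - 2) + 2) by ring.
    set (y := INR n - 2); assert (Hy : 0 <= y) by (unfold y; lra); clearbody y.
    eapply Rle_trans; [apply Rle_abs|].
    apply Rabs_div_le; [poly_nonneg | poly_pos | poly_pos | ring_simplify; poly_nonneg].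
  + destruct (ex_series_row12 : exists l : R, is_series row12 l) as [l Hl].
    exists l; apply (is_series_extR row12); [|exact Hl].
    intros k; rewrite H0, Rabs_pos_eq; [reflexivity | apply Rlt_le, row12_pos].
Qed.

(** Comparison with the telescoping series of 1/sqrt(l+1) - 1/sqrt(l+2). *)
Lemma ex_series_inv_sqrt_cube : ex_series (fun l => sqrt (/ (INR l + 1)) ^ 3).
Proof.
assert (Hlim : is_lim_seq (fun l => sqrt (/ (INR l + 1))) 0).
{ rewrite <- sqrt_0 at 1.
  apply (is_lim_seq_continuous sqrt (fun l => / (INR l + 1)) 0).
  - apply continuity_pt_sqrt; lra.
  - apply is_lim_seq_inv_shift; lra. }
apply (ex_series_leR _ (fun l => 4 * (sqrt (/ (INR l + 1)) - sqrt (/ (INR (S l) + 1)))));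
  [|apply ex_series_scalR, (ex_series_telescoping _ Hlim)].
intros l; rewrite S_INR; pose proof (pos_INR l) as Hl.
assert (H1 : 0 < / (INR l + 1)) by (apply Rinv_0_lt_compat; lra).
assert (H2 : 0 < / (INR l + 1 + 1)) by (apply Rinv_0_lt_compat; lra).
assert (H3 : / (INR l + 1) <= 1) by (rewrite <- Rinv_1; apply Rinv_le_contravar; lra).
assert (H4 : / (INR l + 1) - / (INR l + 1 + 1) = / (INR l + 1) * / (INR l + 1 + 1)) by (field; lra).
assert (H5 : / (INR l + 1) <= 2 * / (INR l + 1 + 1)).
{ apply Rmult_le_reg_r with ((INR l + 1) * (INR l + 1 + 1)); [nra|].
  replace (/ (INR l + 1) * ((INR l + 1) * (INR l + 1 + 1))) with (INR l + 1 + 1) by (field; lra).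
  replace (2 * / (INR l + 1 + 1) * ((INR l + 1) * (INR l + 1 + 1))) with (2 * (INR l + 1)) by (field; lra). lra. }
pose proof (sqrt_lt_R0 _ H1) as S1; pose proof (sqrt_lt_R0 _ H2) as S2.
pose proof (sqrt_sqrt _ (Rlt_le _ _ H1)) as E1; pose proof (sqrt_sqrt _ (Rlt_le _ _ H2)) as E2.
set (t := sqrt (/ (INR l + 1))) in *; set (t' := sqrt (/ (INR l + 1 + 1))) in *.
rewrite <- E1, <- E2 in *.
rewrite Rabs_pos_eq by (apply pow_le; lra).
assert (H6 : t' <= t) by nra.
assert (H7 : (t - t') * (2 * t) >= t ^ 4 / 2).
{ assert ((t - t') * (t + t') >= t ^ 4 / 2).
  { replace ((t - t') * (t + t')) with (t * t - t' * t') by ring. rewrite H4.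
    replace (t ^ 4 / 2) with (t * t * (t * t / 2)) by field.
    apply Rle_ge, Rmult_le_compat_l; nra. }
  nra. }
apply Rmult_le_reg_r with (t / 2); [lra|]. nra.
Qed.

(** The pair F(k,l) = (-1)^k (k+a) l!^2 / ((l+1/2) Gamma(l+3/2+k+a)
    Gamma(l+3/2-k-a)), up to a constant. Row 0 depends on a^2 only and is [row12]
    for a = 1/3 and a = -1/3. The first index, along which the rows move, is k. *)
Section ShiftedRow.
Variables (a U : R).
Hypothesis Ha : a ^ 2 = 1 / 9.
Hypothesis HU : is_lim_seq (fun l => (INR l + 1) * (INR l + 1/2) * row12 l) U.

Let a_bound : -1/2 < a < 1/2.
Proof. split; nra. Qed.

(** Hence none of the linear factors of the ratios vanishes at integers. *)
Let a_half_int (z : Z) : 2 * a <> IZR z.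
Proof.
intros E.
assert (Hz : (-1 < z < 1)%Z) by (split; apply lt_IZR; lra).
assert (z = 0%Z) by lia; subst z; nra.
Qed.

Let kappa_neq0 (k : nat) : a + INR k <> 0.
Proof.
intros E; apply (a_half_int (- (2 * Z.of_nat k))).
rewrite opp_IZR, mult_IZR, <- INR_IZR_INZ; lra.
Qed.

Let kappa_half_neq0 (k : nat) : a + INR k + 1/2 <> 0.
Proof.
intros E; apply (a_half_int (- (2 * Z.of_nat k + 1))).
rewrite opp_IZR, plus_IZR, mult_IZR, <- INR_IZR_INZ; lra.
Qed.

Let l_kappa_neq0 (k l : nat) : INR l + 3/2 - (a + INR k) <> 0.
Proof.
intros E; apply (a_half_int (2 * Z.of_nat l + 3 - 2 * Z.of_nat k)).
rewrite minus_IZR, plus_IZR, !mult_IZR, <- !INR_IZR_INZ; lra.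
Qed.

Let l_kappa_neq0' (k l : nat) : INR l + 1/2 - (a + INR k) <> 0.
Proof.
intros E; apply (a_half_int (2 * Z.of_nat l + 1 - 2 * Z.of_nat k)).
rewrite minus_IZR, plus_IZR, !mult_IZR, <- !INR_IZR_INZ; lra.
Qed.

Let rn (x y : R) : R := - ((a+x+1)*(y+1/2-(a+x)) / ((a+x)*(y+3/2+(a+x)))).
Let rk (x y : R) : R := (y+1)^2*(y+1/2) / ((y+3/2)*(y+3/2+(a+x))*(y+3/2-(a+x))).
Let Rt (x y : R) : R := - (2*(y+1/2)*(y+1/2-(a+x)) / ((a+x)*(a+x+1/2))).

Ltac nonvanishing k l :=
  pose proof (pos_INR k) as P1; pose proof (pos_INR l) as P2;
  pose proof (kappa_neq0 k) as D1; pose proof (kappa_neq0 (S k)) as D2;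
  pose proof (kappa_half_neq0 k) as D3; pose proof (l_kappa_neq0 k l) as D4;
  pose proof (l_kappa_neq0' k l) as D5; pose proof (l_kappa_neq0 k (S l)) as D6;
  rewrite S_INR in D2, D6;
  assert (D7 : INR l + 3/2 + (a + INR k) <> 0) by lra;
  assert (D8 : INR l + 5/2 + (a + INR k) <> 0) by lra.

Let compat : compatible rn rk.
Proof.
intros k l; nonvanishing k l; unfold rn, rk; field; repeat split; lra.
Qed.

Let cert : certified rn rk Rt.
Proof.
intros k l; nonvanishing k l; unfold rn, rk, Rt; field; repeat split; lra.
Qed.

Let shifted_row0 (l : nat) : hterm rn rk 0 l = row12 l.
Proof.
rewrite <- (hterm_row0 rn rk row12).
- unfold row12 at 1; simpl; ring.
- clear l; intros l; rewrite row12_S; unfold rk; pose proof (pos_INR l).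
  replace ((INR l + 3/2) * (INR l + 3/2 + (a + 0)) * (INR l + 3/2 - (a + 0)))
    with ((INR l + 3/2) * ((6 * INR l + 7) * (6 * INR l + 11) / 36))
    by (transitivity ((INR l + 3/2) * ((INR l + 3/2) ^ 2 - a ^ 2)); [rewrite Ha; field | ring]).
  field; repeat split; lra.
Qed.

(** For fixed l the ratio in k exceeds 1 in absolute value as long as k is below
    about sqrt(l/2), so no bound uniform in l tends to 0 in product. The bound
    chosen here telescopes to z L/(L+z^2) with z = k+a and L = l+1, whose peak is
    also of the order of sqrt(l). With q = k+a+1/2 it amounts to |L-q| (L+(q+1/2)^2)
    <= (L+(q-1/2)^2)(L+q), where the difference of the two sides is 2q^3+q/2 or
    2L^2-2q^2+L(2q^2+1/2) according to the sign of L-q. *)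
Let rn_bound (k l : nat) :
  Rabs (rn (INR k) (INR l))
  <= Rabs ((a + INR k + 1) / (a + INR k))
     * ((INR l + 1 + (a + INR k) ^ 2) / (INR l + 1 + (a + INR k + 1) ^ 2)).
Proof.
nonvanishing k l; unfold rn.
set (q := a + INR k + 1/2); set (L := INR l + 1).
assert (Hq : 0 <= q) by (unfold q; lra). assert (HL : 1 <= L) by (unfold L; lra).
replace (- ((a + INR k + 1) * (INR l + 1/2 - (a + INR k)) / ((a + INR k) * (INR l + 3/2 + (a +
    INR k)))))
  with ((a + INR k + 1) / (a + INR k) * - ((L - q) / (L + q)))
  by (unfold q, L; field; split; lra).
rewrite Rabs_mult, Rabs_Ropp; apply Rmult_le_compat_l; [apply Rabs_pos|].
replace (a + INR k) with (q - 1/2) by (unfold q; ring).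
replace (q - 1/2 + 1) with (q + 1/2) by field.
assert (H1 : 0 < L + (q + 1/2) ^ 2) by (pose proof (pow2_ge_0 (q + 1/2)); lra).
assert (H2 : 0 <= L * (L - 1)) by (apply Rmult_le_pos; lra).
assert (H3 : 0 <= q ^ 2 * (L - 1)) by (apply Rmult_le_pos; [apply pow2_ge_0 | lra]).
assert (H4 : 0 <= q ^ 3) by (apply pow_le; lra).
unfold Rdiv at 1; rewrite Rabs_mult, (Rabs_pos_eq (/ _))
  by (apply Rlt_le, Rinv_0_lt_compat; lra).
apply Rle_div_l; [lra|].
replace ((L + (q - 1/2) ^ 2) / (L + (q + 1/2) ^ 2) * (L + q))
  with ((L + (q - 1/2) ^ 2) * (L + q) / (L + (q + 1/2) ^ 2)) by (unfold Rdiv; ring).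
apply Rle_div_r; [exact H1|].
rewrite <- (Rabs_pos_eq (L + (q + 1/2) ^ 2)), <- Rabs_mult by lra.
apply Rabs_le; split; nra.
Qed.

Let shifted_bound (k l : nat) :
  Rabs (hterm rn rk k l)
  <= Rabs ((a + INR k) / a) * ((1 + a ^ 2) * (INR l + 1) / (INR l + 1 + (a + INR k) ^ 2)) * row12 l.
Proof.
pose proof (kappa_neq0 0) as Ha0; simpl INR in Ha0; rewrite Rplus_0_r in Ha0.
pose proof (pos_INR l) as Hl; pose proof (row12_pos l) as Hv.
assert (Hpos : forall z : R, 0 < INR l + 1 + z ^ 2) by (intros z; pose proof (pow2_ge_0 z); lra).
induction k as [|k IH].
- rewrite shifted_row0, (Rabs_pos_eq (row12 l)) by lra; simpl (INR 0); rewrite Rplus_0_r.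
  replace (a / a) with 1 by (field; exact Ha0); rewrite Rabs_R1, Rmult_1_l.
  rewrite <- (Rmult_1_l (row12 l)) at 1; apply Rmult_le_compat_r; [lra|].
  apply Rle_div_r; [apply Hpos|]. pose proof (pow2_ge_0 a). nra.
- rewrite hterm_Sn, Rabs_mult, S_INR by exact compat.
  eapply Rle_trans; [apply Rmult_le_compat; [apply Rabs_pos | apply Rabs_pos | apply rn_bound | exact IH]|].
  apply Req_le.
  replace ((a + (INR k + 1)) / a) with ((a + INR k + 1) / (a + INR k) * ((a + INR k) / a))
    by (field; split; [exact Ha0 | apply kappa_neq0]).
  rewrite (Rabs_mult ((a + INR k + 1) / (a + INR k))).
  replace (a + (INR k + 1)) with (a + INR k + 1) by ring.
  pose proof (Hpos (a + INR k)); pose proof (Hpos (a + INR k + 1)).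
  field; split; lra.
Qed.

(** By the inequality of the means, z L/(L+z^2) <= sqrt(L)/2 with z = |k+a| and L =
    l+1, which multiplied by the decay L^(-2) of row 0 gives the summable bound
    L^(-3/2), uniform in k; for fixed l the terms are O(1/k). *)
Let shifted_Series_to_0 : is_lim_seq (fun n => Series (hterm rn rk n)) 0.
Proof.
pose proof (kappa_neq0 0) as Ha0; simpl INR in Ha0; rewrite Rplus_0_r in Ha0.
set (C := (1 + a ^ 2) * Rabs (/ a)).
assert (HC : 0 <= C) by (apply Rmult_le_pos; [pose proof (pow2_ge_0 a); lra | apply Rabs_pos]).
assert (HB : forall k l, Rabs (hterm rn rk k l) <=
   C * (Rabs (a + INR k) * (INR l + 1) / (INR l + 1 + (a + INR k) ^ 2) * row12 l)).
{ intros k l; eapply Rle_trans; [apply shifted_bound|]; apply Req_le.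
  unfold C, Rdiv; rewrite Rabs_mult; ring. }
apply tannery with (b := fun l => C * (1/2 * sqrt (/ (INR l + 1)) ^ 3)).
- intros k l; eapply Rle_trans; [apply HB|]; apply Rmult_le_compat_l; [exact HC|].
  pose proof (pos_INR l) as Hl; pose proof (row12_le l) as Hv; pose proof (row12_pos l) as Hv0.
  assert (H1 : 0 < / (INR l + 1)) by (apply Rinv_0_lt_compat; lra).
  pose proof (sqrt_lt_R0 _ H1) as S1; pose proof (sqrt_sqrt _ (Rlt_le _ _ H1)) as E1.
  set (t := sqrt (/ (INR l + 1))) in *.
  rewrite <- (pow2_abs (a + INR k)); set (z := Rabs (a + INR k)).
  assert (Hz : 0 <= z) by apply Rabs_pos.
  assert (EL : INR l + 1 = / (t * t)) by (rewrite E1, Rinv_inv; reflexivity).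
  replace (z * (INR l + 1) / (INR l + 1 + z ^ 2)) with (z / (1 + (z * t) ^ 2))
    by (rewrite EL; field; repeat split; apply Rgt_not_eq; nra).
  apply Rle_trans with (z / (1 + (z * t) ^ 2) * (t * t * (t * t))).
  { apply Rmult_le_compat_l; [apply Rle_mult_inv_pos; nra|]. now rewrite E1. }
  replace (z / (1 + (z * t) ^ 2) * (t * t * (t * t))) with (z * t * t ^ 3 / (1 + (z * t) ^ 2))
    by (field; nra).
  apply Rle_div_l; [nra|].
  assert (0 <= t ^ 3) by (apply pow_le; lra).
  assert (0 <= (z * t - 1) ^ 2) by apply pow2_ge_0.
  replace (1/2 * t ^ 3 * (1 + (z * t) ^ 2)) with (z * t * t ^ 3 + 1/2 * (t ^ 3 * (z * t - 1) ^ 2)) by field.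
  nra.
- apply ex_series_scalR, ex_series_scalR, ex_series_inv_sqrt_cube.
- intros l.
  apply is_lim_seq_0_of_le with (v := fun k => (C * (2 * (INR l + 1) * row12 l)) * / (INR k + 1)).
  + intros k; eapply Rle_trans; [apply HB|]; rewrite Rmult_assoc; apply Rmult_le_compat_l; [exact HC|].
    pose proof (pos_INR l) as Hl; pose proof (row12_pos l) as Hv0; pose proof (pos_INR k) as Hk.
    rewrite <- (pow2_abs (a + INR k)); set (z := Rabs (a + INR k)).
    assert (Hz : 0 <= z) by apply Rabs_pos.
    assert (Hkz : INR k + 1 <= z + 3/2) by (unfold z; pose proof (Rle_abs (a + INR k)); lra).
    replace (2 * (INR l + 1) * row12 l * / (INR k + 1)) with (2 * (INR l + 1) / (INR k + 1) * row12 l)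
      by (unfold Rdiv; ring).
    apply Rmult_le_compat_r; [lra|].
    eapply Rle_trans; [apply Rle_abs|].
    apply Rabs_div_le; [apply Rmult_le_pos; lra | pose proof (pow2_ge_0 z); lra | lra |].
    replace (2 * (INR l + 1) * (INR l + 1 + z ^ 2) - z * (INR l + 1) * (INR k + 1))
      with ((INR l + 1) * (2 * INR l + (2 + 2 * z ^ 2 - z * (INR k + 1)))) by ring.
    apply Rmult_le_pos; [lra|].
    assert (z * (INR k + 1) <= z * (z + 3/2)) by (apply Rmult_le_compat_l; lra).
    pose proof (pow2_ge_0 (z - 3/4)); lra.
  + match goal with |- is_lim_seq (fun k => ?c * _) _ =>
      replace (Finite 0) with (Rbar_mult c 0) by (simpl; now rewrite Rmult_0_r) end.
    apply is_lim_seq_scal_l, is_lim_seq_inv_shift; lra.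
Qed.

Lemma shifted_row :
  is_series (fun k => (a ^ 2 - 1/4) / a * / (a + INR k + 1/2) ^ 2
                      + 2 * U / a * ((-1) ^ k / (a + INR k + 1/2))) (Series row12).
Proof.
pose proof (kappa_neq0 0) as Ha0; simpl INR in Ha0; rewrite Rplus_0_r in Ha0.
assert (HG : forall n, is_lim_seq (fun k => Rt (INR n) (INR k) * hterm rn rk n k)
               (- (2 * U / a * ((-1) ^ n / (a + INR n + 1/2))))).
{ intros n.
  assert (E : - (2 * U / a * ((-1) ^ n / (a + INR n + 1/2)))
    = - (2 / ((a + INR n) * (a + INR n + 1/2)))
      * prodR (fun i => - ((a + INR i + 1) / (a + INR i))) n * U).
  { assert (EP : prodR (fun i => - ((a + INR i + 1) / (a + INR i))) n = (-1) ^ n * ((a + INR n) / a)).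
    { clear - kappa_neq0 Ha0; induction n as [|n IH]; cbn [prodR].
      - simpl; field; exact Ha0.
      - rewrite IH, S_INR, pow_S_l; field; split; [exact Ha0 | apply kappa_neq0]. }
    rewrite EP; field; repeat split; auto.
    pose proof (kappa_half_neq0 n); lra. }
  rewrite E.
  apply is_lim_seq_boundary with (w := fun l => (INR l + 1) * (INR l + 1/2)); [exact compat| | | |].
  - intros i; pose proof (kappa_neq0 i); set (z0 := a + INR i) in *.
    pose (f := fun z => - ((z0+1)*(1-(z0+1/2)*z)/(z0*(1+(z0+1/2)*z)))).
    replace (- ((z0 + 1) / z0)) with (f 0) by (unfold f; field; assumption).
    apply is_lim_seq_at_infty.
    + unfold f; auto_derive. rewrite Rmult_0_r, Rplus_0_r, Rmult_1_r; assumption.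
    + intros l; unfold f, rn; fold z0; pose proof (pos_INR l); pose proof (pos_INR i).
      assert (0 < INR l + 3/2 + z0) by (unfold z0; lra).
      field; repeat split; lra.
  - intros k; pose proof (pos_INR k); apply Rgt_not_eq; nra.
  - pose proof (kappa_neq0 n); pose proof (kappa_half_neq0 n); set (z0 := a + INR n) in *.
    pose (f := fun z => - (2*(1-(z0+1/2)*z)/(z0*(z0+1/2)))).
    replace (- (2 / (z0 * (z0 + 1/2)))) with (f 0) by (unfold f; field; split; lra).
    apply is_lim_seq_at_infty.
    + unfold f; auto_derive; trivial.
    + intros l; unfold f, Rt; fold z0; pose proof (pos_INR l); field; repeat split; lra.
  - apply (is_lim_seq_ext _ _ _) with (2 := HU); intros k; now rewrite shifted_row0. }
assert (HT : forall n, Rt (INR n) (INR 0) * hterm rn rk n 0 = (a ^ 2 - 1/4) / a * / (a + INR n + 1/2) ^ 2).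
{ intros n.
  assert (EH : hterm rn rk n 0 * ((a + INR n) ^ 2 - 1/4) = (a + INR n) / a * (a ^ 2 - 1/4)).
  { induction n as [|n IH].
    - unfold hterm; simpl; field; exact Ha0.
    - rewrite hterm_Sn, S_INR by exact compat.
      nonvanishing n O; simpl (INR 0) in *.
      transitivity ((a + INR n + 1) / (a + INR n) * (hterm rn rk n 0 * ((a + INR n) ^ 2 - 1/4))).
      + unfold rn; field; split; lra.
      + rewrite IH; field; split; lra. }
  nonvanishing n O; simpl (INR 0) in *.
  assert (Hne : (a + INR n) ^ 2 - 1/4 <> 0).
  { replace ((a + INR n) ^ 2 - 1/4) with (- ((0 + 1/2 - (a + INR n)) * (a + INR n + 1/2))) by field.
    apply Ropp_neq_0_compat, Rmult_integral_contrapositive_currified; assumption. }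
  apply Rmult_eq_reg_r with ((a + INR n) ^ 2 - 1/4); [|exact Hne].
  rewrite Rmult_assoc, EH; unfold Rt; field; repeat split; lra. }
apply (is_series_extR (fun n => Rt (INR n) (INR 0) * hterm rn rk n 0
         - - (2 * U / a * ((-1) ^ n / (a + INR n + 1/2))))).
{ intros n; rewrite HT; ring. }
apply (wz_telescoping (hterm rn rk) (fun n k => Rt (INR n) (INR k) * hterm rn rk n k)).
- intros n k; now apply hterm_wz.
- apply (is_series_extR row12); [intros; now rewrite shifted_row0|]. apply Series_correct, ex_series_row12.
- exact HG.
- exact shifted_Series_to_0.
Qed.

End ShiftedRow.

(** With D the sum on the left and K = L_{-3}(2): separating odd and even k in K
    gives D minus the sum of 1/(6k+2)^2 - 1/(6k+4)^2, which is K/4. *)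
Lemma is_series_L_m3_mod6 :
  is_series (fun k => / (6 * INR k + 1) ^ 2 - / (6 * INR k + 5) ^ 2) (5/4 * L (-3) 2).
Proof.
pose proof is_series_L_m3 as H.
replace (5/4 * L (-3) 2) with (L (-3) 2 + 1/4 * L (-3) 2) by field.
apply (is_series_extR _ _ _) with
  (2 := is_series_plusR _ _ _ _ (is_series_group2 _ _ H) (is_series_scalR (1/4) _ _ H)).
intros k; rewrite plus_INR, mult_INR; simpl INR; pose proof (pos_INR k); field; lra.
Qed.

(** For a = 1/3 and a = -1/3 the same sum of row 0 involves the classes 5 and 1
    modulo 6, with opposite signs. Only their mean brings in the antisymmetric
    combinations that are L_{-3}(2) and [L12_1]. *)
Lemma Series_row12 (U : R) :
  is_lim_seq (fun l => (INR l + 1) * (INR l + 1/2) * row12 l) U ->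
  Series row12 = 75/8 * L (-3) 2 - 18 * U * L12_1.
Proof.
intros HU.
apply is_series_uniq with (a := fun k =>
  1/2 * ((((1/3) ^ 2 - 1/4) / (1/3) * / (1/3 + INR k + 1/2) ^ 2
          + 2 * U / (1/3) * ((-1) ^ k / (1/3 + INR k + 1/2)))
       + (((-1/3) ^ 2 - 1/4) / (-1/3) * / (-1/3 + INR k + 1/2) ^ 2
          + 2 * U / (-1/3) * ((-1) ^ k / (-1/3 + INR k + 1/2))))).
- replace (Series row12) with (1/2 * (Series row12 + Series row12)) by field.
  apply is_series_scalR, is_series_plusR; apply shifted_row; try exact HU; field.
- replace (75/8 * L (-3) 2 - 18 * U * L12_1)
    with (15/2 * (5/4 * L (-3) 2) + - (18 * U) * L12_1) by field.
  apply (is_series_extR _ _ _) with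
    (2 := is_series_plusR _ _ _ _ (is_series_scalR (15/2) _ _ is_series_L_m3_mod6)
            (is_series_scalR (- (18 * U)) _ _ is_series_L12_1)).
  intros k; generalize ((-1) ^ k); intros e; pose proof (pos_INR k).
  field; repeat split; lra.
Qed.

Lemma sum_5n1 :
  is_sum_from_1
    (fun n => (-1) ^ (n + 1)
              * (poch 1 n ^ 3 / (poch (1/2) n * poch (1/4) n * poch (3/4) n))
              * ((5 * INR n - 1) / INR n ^ 3) * (3 / 4) ^ (2 * n))
    (45 / 2 * L (-3) 2).
Proof.
destruct row12_limit as [U HU].
unfold is_sum_from_1.
replace (45 / 2 * L (-3) 2) with (12/5 * (Series row12 + 18 * U * L12_1))
  by (rewrite (Series_row12 U HU); field).
apply (is_series_extR _ _ _) with (2 := is_series_scalR (12/5) _ _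
  (is_series_plusR _ _ _ _ (sum_5n1_row U HU) (is_series_scalR (18 * U) _ _ is_series_log_alternating_term))).
intros n; cbv beta.
match goal with |- 12 / 5 * (5 / 12 * ?x - ?y + ?y) = ?x' => generalize x end; intros x; field.
Qed.

(** * The nine evaluations *)

Theorem theorem3 :
  is_sum_from_1
    (fun n => (-1) ^ (n + 1) * (poch 1 n ^ 3 / poch (1/2) n ^ 3)
              * ((4 * INR n - 1) / INR n ^ 3))
    (16 * L (-4) 2)
  /\
  is_sum_from_1
    (fun n => poch 1 n ^ 3 / poch (1/2) n ^ 3
              * ((3 * INR n - 1) / INR n ^ 3) * (1 / 2 ^ (2 * n)))
    (PI ^ 2 / 2)
  /\
  is_sum_from_1
    (fun n => poch 1 n ^ 3 / poch (1/2) n ^ 3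
              * ((21 * INR n - 8) / INR n ^ 3) * (1 / 2 ^ (6 * n)))
    (PI ^ 2 / 6)
  /\
  is_sum_from_1
    (fun n => (-1) ^ (n + 1) * (poch 1 n ^ 3 / poch (1/2) n ^ 3)
              * ((3 * INR n - 1) / INR n ^ 3) * (1 / 2 ^ (3 * n)))
    (2 * L (-4) 2)
  /\
  is_sum_from_1
    (fun n => poch 1 n ^ 3 / (poch (1/2) n * poch (1/3) n * poch (2/3) n)
              * ((10 * INR n - 3) / INR n ^ 3) * (2 / 27) ^ n)
    (PI ^ 2 / 2)
  /\
  is_sum_from_1
    (fun n => poch 1 n ^ 3 / (poch (1/2) n * poch (1/3) n * poch (2/3) n)
              * ((11 * INR n - 3) / INR n ^ 3) * (16 / 27) ^ n)
    (8 * PI ^ 2)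
  /\
  is_sum_from_1
    (fun n => (-1) ^ (n + 1)
              * (poch 1 n ^ 3 / (poch (1/2) n * poch (1/3) n * poch (2/3) n))
              * ((15 * INR n - 4) / INR n ^ 3) * (1 / 4 ^ n))
    (27 * L (-3) 2)
  /\
  is_sum_from_1
    (fun n => (-1) ^ (n + 1)
              * (poch 1 n ^ 3 / (poch (1/2) n * poch (1/4) n * poch (3/4) n))
              * ((5 * INR n - 1) / INR n ^ 3) * (3 / 4) ^ (2 * n))
    (45 / 2 * L (-3) 2)
  /\
  is_sum_from_1
    (fun n => poch 1 n ^ 3 / (poch (1/2) n * poch (1/4) n * poch (3/4) n)
              * ((35 * INR n - 8) / INR n ^ 3) * (3 / 4) ^ (4 * n))
    (12 * PI ^ 2).
Proof.
repeat split.
- exact sum_4n1_alternating.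
- exact sum_3n1_quarter.
- exact sum_21n8.
- exact sum_3n1_alternating.
- exact sum_10n3.
- exact sum_11n3.
- exact sum_15n4.
- exact sum_5n1.
- exact sum_35n8.
Qed.
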